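(* The C*-algebra $C([0,1)^* )$ of continuous complex-valued functions on the Stone--Čech remainder $[0,1)^*=\beta[0,1)\setminus[0,1)$ of the half-open interval $[0,1)$ is countably saturated (as a metric structure in the language of C*-algebras).
   Context: $\beta X$ denotes the Stone--Čech compactification of $X$ and $X^*=\beta X\setminus X$ its remainder. C*-algebras are regarded as metric structures in the logic of metric structures (continuous logic): the domains are closed balls of fixed radius centered at $0$, the function symbols are the C*-algebra operations, atomic formulas are norms of *-polynomials, and formulas are built from atomic formulas by continuous real-valued connectives and the quantifiers $\sup$ and $\inf$ ranging over domains. Every variable ranges over a fixed domain (a ball of fixed radius). A condition over a structure $A$ is an expression $\phi(\bar x)=r$ with $\phi$ a formula, possibly with parameters from $A$, and $r\in\mathbb R$. A type over $A$ is a set of conditions over $A$ whose free variables are all among a fixed finite tuple $\bar x$. A type is realized in $A$ if there is a tuple $\bar a$ in $A$ (of the appropriate sort/domain) with $\phi(\bar a)^A=r$ for every condition $\phi(\bar x)=r$ in it. A type is consistent if for every finite subset of it and every $\epsilon>0$ there is a tuple $\bar a$ in $A$ such that $|\phi(\bar a)^A-r|\le\epsilon$ for all conditions $\phi(\bar x)=r$ in the finite subset. $A$ is countably saturated ($\aleph_1$-saturated) if every consistent type over $A$ with fewer than $\aleph_1$ (i.e., countably many) conditions is realized in $A$. *)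

(* Defs.v *)
(* MathComp with MathComp-Analysis; the complex numbers R[i] over R : realType
   come from mathcomp-real-closed. *)
From HB Require Import structures.
From mathcomp Require Import all_boot all_order all_algebra.
From mathcomp Require Import complex.
From mathcomp Require Import all_classical all_reals all_analysis.

Set Implicit Arguments.
Unset Strict Implicit.
Unset Printing Implicit Defensive.

Import Order.TTheory GRing.Theory Num.Theory.
Import numFieldNormedType.Exports.

Local Open Scope classical_set_scope.
Local Open Scope ring_scope.

(* The topology on a coercion of a set to a type is the subspace topology. *)
Definition unit_interval (R : realType) : topologicalType :=
  [set` `[0, 1]] : set R.

Definition half_open_interval (R : realType) : topologicalType :=
  [set` `[0, 1[] : set R.

Section StoneCech.
Variables (R : realType) (X : topologicalType).

Definition unit_cube : topologicalType :=
  prod_topology (fun _ : continuousType X (unit_interval R) => unit_interval R).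

Definition stone_cech_ev (x : X) : unit_cube := fun f => f x.

Definition stone_cech : topologicalType := closure (range stone_cech_ev).

Definition stone_cech_in (x : X) : stone_cech :=
  exist _ (stone_cech_ev x)
    (mem_set (subset_closure (imageT stone_cech_ev x))).

Definition stone_cech_remainder : topologicalType := ~` range stone_cech_in.

End StoneCech.

(* A structure for the language of C*-algebras.  The sorts (domains) are the
   closed balls of [cnorm] centered at [czero]. *)
Record cstar_structure (R : realType) := CstarStructure {
  carrier :> Type;
  czero : carrier;
  cadd : carrier -> carrier -> carrier;
  cscale : R[i] -> carrier -> carrier;
  cmul : carrier -> carrier -> carrier;
  cstar : carrier -> carrier;
  cnorm : carrier -> R
}.

Section ContinuousFunctions.
Variables (R : realType) (K : topologicalType).

(* [^o] equips R[i] with the metric topology of its modulus. *)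
Notation C := R[i]^o.
Implicit Types f g : continuousType K C.

Lemma continuous_conjc : continuous (@conjc R : C -> C).
Proof.
move=> z U /nbhs_ballP[e e0 zeU]; apply/nbhs_ballP; exists e => // w zew.
apply: zeU; move: zew; rewrite -!ball_normE /= -raddfB /=.
have -> // : `|(z - w)^*%C| = `|z - w| :> R[i].
by case: (z - w) => a b; rewrite /Num.norm /= sqrrN.
Qed.

Lemma continuous_addf f g : continuous (fun x => f x + g x : C).
Proof. by move=> x; apply: cvgD; exact: cts_fun. Qed.

Lemma continuous_scalef (a : R[i]) f : continuous (fun x => a * f x : C).
Proof. by move=> x; apply: cvgM; [exact: cvg_cst|exact: cts_fun]. Qed.

Lemma continuous_mulf f g : continuous (fun x => f x * g x : C).
Proof. by move=> x; apply: cvgM; exact: cts_fun. Qed.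

Lemma continuous_conjf f : continuous (fun x => (f x)^*%C : C).
Proof.
by move=> x; apply: continuous_comp; [exact: cts_fun|exact: continuous_conjc].
Qed.

(* For compact Hausdorff K, this is the C*-algebra C(K). *)
Definition continuous_functions : cstar_structure R := {|
  carrier := continuousType K C;
  czero := (cst 0 : continuousType K C);
  cadd := fun f g => mkcts (@continuous_addf f g);
  cscale := fun a f => mkcts (@continuous_scalef a f);
  cmul := fun f g => mkcts (@continuous_mulf f g);
  cstar := fun f => mkcts (@continuous_conjf f);
  cnorm := fun f => sup (range (fun x => Normc.normc (f x)))
|}.

End ContinuousFunctions.

Section Syntax.
Variables (R : realType) (A : cstar_structure R).

(* *-polynomials with parameters from A in the variables indexed by 'I_n. *)
Inductive term (n : nat) : Type :=
| TVar of 'I_n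
| TParam of A
| TZero
| TAdd of term n & term n
| TScale of R[i] & term n
| TMul of term n & term n
| TStar of term n.

(* [formula n] is the type of formulas with free variables indexed by 'I_n.
   The quantifiers range over the closed ball of the given radius, and bind
   the variable [ord0]; the other variables are shifted by one. *)
Inductive formula : nat -> Type :=
| FNorm n of term n : formula n
| FConn n k (u : 'rV[R]_k -> R) of continuous u & ('I_k -> formula n) :
    formula n
| FSup n of {posnum R} & formula n.+1 : formula n
| FInf n of {posnum R} & formula n.+1 : formula n.

End Syntax.

Section Semantics.
Variables (R : realType) (A : cstar_structure R).

Definition cball (r : R) : set A := [set a | cnorm a <= r].

Fixpoint teval n (v : 'I_n -> A) (t : term A n) : A :=
  match t with
  | TVar i => v i
  | TParam a => a
  | TZero => czero A
  | TAdd t1 t2 => cadd (teval v t1) (teval v t2)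
  | TScale c t1 => cscale c (teval v t1)
  | TMul t1 t2 => cmul (teval v t1) (teval v t2)
  | TStar t1 => cstar (teval v t1)
  end.

Definition extend n (a : A) (v : 'I_n -> A) (i : 'I_n.+1) : A :=
  oapp v a (unlift ord0 i).

Fixpoint feval n (phi : formula A n) : ('I_n -> A) -> R :=
  match phi with
  | FNorm _ t => fun v => cnorm (teval v t)
  | FConn _ _ u _ psi => fun v => u (\row_i feval (psi i) v)
  | FSup _ r psi => fun v => sup [set feval psi (extend a v) | a in cball r%:num]
  | FInf _ r psi => fun v => inf [set feval psi (extend a v) | a in cball r%:num]
  end.

(* The pair (phi, r) stands for the condition phi = r. *)
Definition condition (n : nat) : Type := (formula A n * R)%type.

(* The i-th free variable ranges over the closed ball of radius d i. *)
Definition in_domains n (d : 'I_n -> {posnum R}) (v : 'I_n -> A) :=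
  forall i, cball (d i)%:num (v i).

Definition consistent n (d : 'I_n -> {posnum R}) (p : set (condition n)) :=
  forall F : set (condition n), finite_set F -> F `<=` p ->
  forall e : R, 0 < e ->
  exists2 v, in_domains d v & forall c, F c -> `|feval c.1 v - c.2| <= e.

Definition realized n (d : 'I_n -> {posnum R}) (p : set (condition n)) :=
  exists2 v, in_domains d v & forall c, p c -> feval c.1 v = c.2.

Definition countably_saturated :=
  forall n (d : 'I_n -> {posnum R}) (p : set (condition n)),
  countable p -> consistent d p -> realized d p.

End Semantics.

(* Main.v *)
From mathcomp Require Import all_boot all_order all_algebra.
From mathcomp Require Import complex.
From mathcomp Require Import all_classical all_reals all_analysis.
From mathcomp Require Import ring lra.
Require Import Defs.

Set Implicit Arguments.
Unset Strict Implicit.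
Unset Printing Implicit Defensive.

Import Order.TTheory GRing.Theory Num.Theory.
Import numFieldNormedType.Exports.

Local Open Scope classical_set_scope.
Local Open Scope ring_scope.

(** The remainder of the interval carries the algebra of bounded continuous
    functions on the half-line modulo those vanishing at infinity (Tietze extension
    and the compactness of the Stone-Cech compactification), so that the norm of a
    class is a limit superior; [asymptotic_represents] records this. The saturation
    proof only uses this description, and is a composition argument in the style of
    Feferman-Vaught and Shelah: a formula does not see any bounded part of the
    half-line, and sees the rest only through the local behavior of its arguments on
    the intervals of a partition.

    For a formula [phi], tuples [a] and [a'] of functions are [similar] on an
    interval [s, t] when a back-and-forth game following the quantifiers of [phi]
    cannot tell them apart up to [e]; a move on one side is answered by a function
    with exactly the same values at [s] and [t]. Three facts carry the argument.

    - If [a] and [a'] are similar on every interval of a partition of a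
      neighborhood of infinity, then [phi] takes close values at their classes
      ([similar_feval]). Indeed the answers on the intervals agree at the common
      endpoints, so they glue to one continuous answer.
    - For fixed [phi] and [e], finitely many colors, the same for all intervals,
      suffice to color tuples so that equal colors on an interval imply similarity
      there ([similar_coloring]).
    - With an ultrafilter on indices and one at infinity on the line, every finite
      coloring of triples [(n, s, t)] is constant for almost all [n], almost all [s],
      almost all [t] ([frequent_color]).

    Let [x n] be functions for tuples satisfying the first conditions of a consistent
    type up to small errors. A diagonal choice over all the conditions and
    precisions yields a subsequence [y] and a sequence of cut points [t l] going to
    infinity such that, for the coloring attached to the [m]-th demand, [y k] and
    [y m] have the same color on [t l, t (l + 1)] as soon as [m <= k <= l]
    ([frequent_diagonal]). The colors also record the values at left endpoints, so
    [y l] and [y (l + 1)] nearly agree at [t (l + 1)] and, after a small correction,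
    the restrictions of [y l] to [t l, t (l + 1)] splice to a continuous tuple. It
    is similar to [y m] on all the intervals beyond [t m], so it satisfies the
    [m]-th demand, for every [m]. *)

(** * Complex moduli and the topology of the complex plane *)

Section Modulus.
Variable R : realType.
Local Notation C := R[i]^o.
Local Notation modulus := (@Normc.normc R).
Implicit Types z w : R[i].

Lemma modulus_ge0 z : 0 <= modulus z.
Proof. by case: z => a b; exact: sqrtr_ge0. Qed.

Lemma modulus_real (x : R) : modulus x%:C%C = `|x|.
Proof. by rewrite /= expr0n addr0 sqrtr_sqr. Qed.

Lemma modulusB z w : modulus (z - w) = modulus (w - z).
Proof. by rewrite -opprB normcN. Qed.

Lemma modulus_dist_triangle w z z' :
  modulus (z - z') <= modulus (z - w) + modulus (w - z').
Proof. by rewrite -[z - z'](subrKA w); exact: le_normcD. Qed.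

Lemma modulus_lip z w : `|modulus z - modulus w| <= modulus (z - w).
Proof.
rewrite ler_norml lerBlDl lerBrDr addrC.
have := le_normcD (z - w) w; have := le_normcD (w - z) z.
rewrite !subrK [modulus (w - z)]modulusB; lra.
Qed.

Lemma modulus_conj z : modulus z^*%C = modulus z.
Proof. by case: z => a b /=; rewrite sqrrN. Qed.

Lemma modulus_Re z : `|complex.Re z| <= modulus z.
Proof. by case: z => a b /=; rewrite -sqrtr_sqr ler_wsqrtr// lerDl sqr_ge0. Qed.

Lemma modulus_Im z : `|complex.Im z| <= modulus z.
Proof. by case: z => a b /=; rewrite -sqrtr_sqr ler_wsqrtr// lerDr sqr_ge0. Qed.

Lemma modulus_le_ReIm z : modulus z <= `|complex.Re z| + `|complex.Im z|.
Proof.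
case: z => a b; have -> : Complex a b = (a%:C + b%:C * 'i)%C.
  by apply/eqP; rewrite eq_complex /= !(mul0r, mulr0, mulr1, subr0, addr0, add0r) !eqxx.
apply: le_trans (le_normcD _ _) _; rewrite Normc.normcM !modulus_real.
by rewrite /= !(expr0n, expr1n, mul0r, mulr0, mulr1, subr0, addr0, add0r) sqrtr1 mulr1.
Qed.

(** The norm of [R[i]^o] takes its values in [R[i]], so convergence there quantifies
    over radii in [R[i]]; all the estimates below have real radii. *)
Lemma cvg_modulusP (T : Type) (F : set_system T) (FF : Filter F) (f : T -> C) (z : C) :
  f @ F --> z <-> forall e, 0 < e -> \forall x \near F, modulus (z - f x) < e.
Proof.
split=> [/cvgrPdist_lt h e e0|h].
  have /h : (0 : R[i]) < e%:C%C by rewrite ltcR.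
  by apply: filterS => x; rewrite /Num.norm/= ltcR.
apply/cvgrPdist_lt => -[e e']; rewrite ltcE/= => /andP[/eqP-> e0].
by have := h _ e0; apply: filterS => x; rewrite -ltcR.
Qed.

Lemma modulus_lip_continuous (f : C -> R) :
  (forall z w, `|f z - f w| <= modulus (z - w)) -> continuous f.
Proof.
move=> f_lip z; have FF : Filter (nbhs z) by exact: nbhs_filter.
apply/(@cvgrPdist_lt _ _ _ (nbhs z)) => e e0.
have /cvg_modulusP/(_ _ e0) : (id : C -> C) x @[x --> z] --> z by exact: cvg_id.
by apply: filterS => w; apply: le_lt_trans; exact: f_lip.
Qed.

Lemma continuous_modulus : continuous (modulus : C -> R).
Proof. exact/modulus_lip_continuous/modulus_lip. Qed.

Lemma continuous_Re : continuous (@complex.Re R : C -> R).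
Proof.
by apply: modulus_lip_continuous => z w; rewrite -raddfB; exact: modulus_Re.
Qed.

Lemma continuous_Im : continuous (@complex.Im R : C -> R).
Proof.
by apply: modulus_lip_continuous => z w; rewrite -raddfB; exact: modulus_Im.
Qed.

Lemma continuous_real_complex : continuous (fun x : R => x%:C%C : C).
Proof.
move=> x; apply/cvg_modulusP => e e0.
have /cvgrPdist_lt/(_ _ e0) : id y @[y --> x] --> x by exact: cvg_id.
by apply: filterS => y; rewrite -rmorphB modulus_real.
Qed.

Lemma continuous_Complex (T : topologicalType) (f g : T -> R) :
  continuous f -> continuous g -> continuous (fun x => Complex (f x) (g x) : C).
Proof.
move=> fc gc x; apply/cvg_modulusP => e e0.
have e20 : 0 < e / 2 by rewrite divr_gt0.
have /cvgrPdist_lt/(_ _ e20) fe := fc x.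
have /cvgrPdist_lt/(_ _ e20) := gc x; apply: filterS2 fe => y fe ge.
by rewrite (le_lt_trans (modulus_le_ReIm _))// (splitr e); exact: ltrD.
Qed.

(** Keeps functions inside the ball of radius [r] over which a quantifier ranges,
    moving each value by no more than it overshoots the ball. *)
Definition disc_retract (r : R) (z : C) : C := (r / Num.max r (modulus z))%:C%C * z.

Lemma disc_retract_id r z : 0 < r -> modulus z <= r -> disc_retract r z = z.
Proof.
by move=> r0 zr; rewrite /disc_retract (max_idPl zr) divff ?gt_eqF// mul1r.
Qed.

Lemma modulus_disc_retract r z : 0 < r -> modulus (disc_retract r z) <= r.
Proof.
move=> r0; have m0 : 0 < Num.max r (modulus z) by rewrite lt_max r0.
rewrite Normc.normcM modulus_real ger0_norm ?divr_ge0 ?(ltW m0) ?(ltW r0)//.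
by rewrite mulrAC ler_pdivrMr// ler_pM2l// le_max lexx orbT.
Qed.

Lemma disc_retract_dist r z : 0 < r ->
  modulus (disc_retract r z - z) <= Num.max 0 (modulus z - r).
Proof.
move=> r0; have m0 : 0 < Num.max r (modulus z) by rewrite lt_max r0.
have [zr|rz] := leP (modulus z) r.
  by rewrite disc_retract_id// subrr Normc.normc0 le_max lexx.
rewrite le_max; apply/orP; right; rewrite /disc_retract (max_idPr (ltW rz)).
have z0 : 0 < modulus z by exact: lt_trans rz.
rewrite -[X in _ - X]mul1r -mulrBl Normc.normcM -[1]/(1%:C%C) -rmorphB modulus_real.
rewrite distrC ger0_norm ?subr_ge0 ?ler_pdivrMr ?mul1r ?(ltW rz)//.
by rewrite mulrBl mul1r divfK// gt_eqF.
Qed.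

Lemma continuous_disc_retract r : 0 < r -> continuous (disc_retract r).
Proof.
move=> r0 z; have FF : Filter (nbhs z) by exact: nbhs_filter.
have hc : continuous (fun z : C => r / Num.max r (modulus z)).
  move=> w; have FFw : Filter (nbhs w) by exact: nbhs_filter.
  apply: (@cvgM _ _ (nbhs w)); first exact: cvg_cst.
  apply: (@cvgV _ _ (nbhs w)); first by rewrite gt_eqF// lt_max r0.
  apply: (@continuous_max R C (cst r) modulus); first exact: cvg_cst.
  exact: continuous_modulus.
apply: (@cvgM _ _ (nbhs z)); last exact: cvg_id.
by apply: (@cvg_comp _ _ _ _ _ (nbhs z) _ _ (hc z)); exact: continuous_real_complex.
Qed.

End Modulus.

(** * Suprema and continuous connectives *)

Section RealEstimates.
Variable R : realType.

Lemma sup_norm_le (A : set R) (B : R) : A !=set0 ->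
  (forall x, A x -> `|x| <= B) -> `|sup A| <= B.
Proof.
move=> A0 AB; have Aub : ubound A B by move=> x /AB; rewrite ler_norml => /andP[].
have [x Ax] := A0; rewrite ler_norml; apply/andP; split; last exact: ge_sup.
apply: (@le_trans _ _ x); first by have := AB _ Ax; rewrite ler_norml => /andP[].
by apply: sup_upper_bound => //; split=> //; exists B.
Qed.

Lemma inf_norm_le (A : set R) (B : R) : A !=set0 ->
  (forall x, A x -> `|x| <= B) -> `|inf A| <= B.
Proof.
move=> A0 AB; rewrite /inf normrN; apply: sup_norm_le; first exact/nonemptyN.
by move=> x [y Ay <-]; rewrite normrN; exact: AB.
Qed.

Lemma sup_dist_le (A A' : set R) (B e : R) : A !=set0 ->
  (forall x, A x -> `|x| <= B) -> (forall x, A' x -> `|x| <= B) ->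
  (forall x, A x -> exists2 y, A' y & `|x - y| <= e) ->
  (forall y, A' y -> exists2 x, A x & `|x - y| <= e) -> `|sup A - sup A'| <= e.
Proof.
move=> A0 AB A'B AA' A'A.
have A'0 : A' !=set0 by have [x /AA'[y A'y _]] := A0; exists y.
have Asup : has_sup A.
  by split=> //; exists B => x /AB; rewrite ler_norml => /andP[].
have A'sup : has_sup A'.
  by split=> //; exists B => x /A'B; rewrite ler_norml => /andP[].
rewrite ler_distlC; apply/andP; split.
  rewrite lerBlDr; apply: ge_sup => // x /AA'[y A'y].
  have := sup_upper_bound A'sup A'y; rewrite ler_norml; lra.
apply: ge_sup => // y /A'A[x Ax].
have := sup_upper_bound Asup Ax; rewrite ler_norml; lra.
Qed.

Lemma inf_dist_le (A A' : set R) (B e : R) : A !=set0 ->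
  (forall x, A x -> `|x| <= B) -> (forall x, A' x -> `|x| <= B) ->
  (forall x, A x -> exists2 y, A' y & `|x - y| <= e) ->
  (forall y, A' y -> exists2 x, A x & `|x - y| <= e) -> `|inf A - inf A'| <= e.
Proof.
move=> A0 AB A'B AA' A'A; rewrite /inf -opprD normrN.
apply: (@sup_dist_le _ _ B); first exact/nonemptyN.
- by move=> _ [x Ax <-]; rewrite normrN; exact: AB.
- by move=> _ [x Ax <-]; rewrite normrN; exact: A'B.
- move=> _ [x /AA'[y A'y xy] <-]; exists (- y); first by exists y.
  by rewrite -opprD normrN.
- move=> _ [y /A'A[x Ax xy] <-]; exists (- x); first by exists x.
  by rewrite -opprD normrN.
Qed.

Lemma common_lower_bound (I : finType) (e : I -> R) : (forall i, 0 < e i) ->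
  exists2 e', 0 < e' & forall i, e' <= e i.
Proof.
move=> e0; have : \forall e' \near 0^'+, forall i, e' <= e i.
  by apply: filter_forall => i; exact: nbhs_right_le.
by move=> /(filterI (nbhs_right_gt 0))/filter_ex[e' [/= e'0 e'e]]; exists e'.
Qed.

Definition box k (B : R) : set 'rV[R]_k := [set x | forall i, `|x ord0 i| <= B].

Lemma box_compact k (B : R) : compact (@box k B).
Proof.
have -> : @box k B = [set x | forall i, `[- B, B]%classic (x ord0 i)].
  by apply/seteqP; split=> x /= + i => /(_ i); rewrite in_itv/= ler_norml.
by apply: (@rV_compact R k (fun=> `[- B, B]%classic)) => i; exact: segment_compact.
Qed.

Lemma box_bounded k (u : 'rV[R]_k -> R) (B : R) : continuous u ->
  exists2 D, 0 <= D & forall x, box B x -> `|u x| <= D.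
Proof.
move=> u_cts; have /compact_bounded[D [_ DP]] : compact (u @` @box k B).
  by apply: continuous_compact; [exact: continuous_subspaceT|exact: box_compact].
exists (Num.max 0 (D + 1)); first by rewrite le_max lexx.
by move=> x Bx; apply: (DP (Num.max 0 (D + 1))); [rewrite lt_max ltrDl ltr01 orbT|exists x].
Qed.

Lemma box_unif_continuous k (u : 'rV[R]_k -> R) (B eta : R) :
  continuous u -> 0 < eta -> exists2 e, 0 < e &
  forall x y : 'rV[R]_k, box B x ->
    (forall i, `|x ord0 i - y ord0 i| <= e) -> `|u x - u y| <= eta.
Proof.
move=> u_cts eta0.
pose P (e : R) (x : 'rV[R]_k) := forall y : 'rV[R]_k,
  (forall i, `|x ord0 i - y ord0 i| <= e) -> `|u x - u y| <= eta.
have : \forall e \near 0^'+, @box k B `<=` P e.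
  apply: ((compact_near_coveringP _).1 (@box_compact k B)) => x _.
  have eta20 : 0 < eta / 2 by rewrite divr_gt0.
  have /cvgrPdist_le/(_ _ eta20)/nbhs_ballP[d /= d0 xd] := u_cts x.
  have d20 : 0 < d / 2 by rewrite divr_gt0.
  exists (ball x (d / 2), [set e : R | e < d / 2]).
    split => /=; first exact: nbhsx_ballx.
    exact: nbhs_right_lt.
  move=> [y e] /= [xy ed] z yz.
  have uy : `|u x - u y| <= eta / 2.
    by apply: xd; apply: le_ball xy; lra.
  have uz : `|u x - u z| <= eta / 2.
    apply: xd; rewrite [d]splitr; apply: ball_triangle xy _.
    by split=> // i j; rewrite ord1; apply: le_lt_trans (yz j) ed.
  rewrite -[u y - u z](subrKA (u x)) (le_trans (ler_normD _ _))//.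
  by rewrite distrC (splitr eta) lerD.
move=> /(filterI (nbhs_right_gt 0))/filter_ex[e [/= e0 he]].
by exists e => // x y xB; exact: he.
Qed.

End RealEstimates.

(** * Back-and-forth relations and finite colorings *)

Section Zigzag.
Variables (T : Type) (D : set T).

Definition zigzag (P : T -> T -> Prop) :=
  (forall x, D x -> exists2 y, D y & P x y) /\
  (forall y, D y -> exists2 x, D x & P x y).

Lemma zigzag_sub (P Q : T -> T -> Prop) :
  (forall x y, D x -> D y -> P x y -> Q x y) -> zigzag P -> zigzag Q.
Proof.
move=> PQ [P1 P2]; split=> [x Dx|y Dy].
  by have [y Dy Pxy] := P1 x Dx; exists y => //; exact: PQ.
by have [x Dx Pxy] := P2 y Dy; exists x => //; exact: PQ.
Qed.

Lemma zigzag_refl (P : T -> T -> Prop) : (forall x, D x -> P x x) -> zigzag P.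
Proof. by move=> Pxx; split=> x Dx; exists x => //; exact: Pxx. Qed.

Lemma zigzag_comp (P Q S : T -> T -> Prop) :
  (forall x y z, P x y -> Q y z -> S x z) -> zigzag P -> zigzag Q -> zigzag S.
Proof.
move=> PQS [P1 P2] [Q1 Q2]; split=> [x Dx|z Dz].
  have [y Dy Pxy] := P1 x Dx; have [z Dz Qyz] := Q1 y Dy.
  by exists z => //; exact: PQS Pxy Qyz.
have [y Dy Qyz] := Q2 z Dz; have [x Dx Pxy] := P2 y Dy.
by exists x => //; exact: PQS Pxy Qyz.
Qed.

(** The colors met in [D] form one of finitely many possible sets, so they color
    the pair of [D] and [c] in turn; this is how a coloring passes a quantifier. *)
Definition hit_colors (K : finType) (c : T -> K) : {set K} :=
  [set k | `[< exists2 x, D x & c x = k >]].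

Lemma hit_colors_zigzag (K : finType) (c c' : T -> K) :
  hit_colors c = hit_colors c' -> zigzag (fun x y => c x = c' y).
Proof.
have hitP (g : T -> K) k : (k \in hit_colors g) <-> exists2 x, D x & g x = k.
  by rewrite inE; split=> /asboolP.
move=> cc'; split=> [x Dx|y Dy].
  have /hitP[y Dy xy] : c x \in hit_colors c' by rewrite -cc'; apply/hitP; exists x.
  by exists y.
by have /hitP : c' y \in hit_colors c by rewrite cc'; apply/hitP; exists y.
Qed.

End Zigzag.

Section FiniteColorings.
Variable R : realType.

Lemma finite_coloring_real (B e : R) : 0 < e -> exists N (c : R -> 'I_N.+1),
  forall x y, `|x| <= B -> `|y| <= B -> c x = c y -> `|x - y| <= e.
Proof.
move=> e0; exists (Num.truncn ((B + B) / e)), (fun x => inord (Num.truncn ((x + B) / e))).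
move=> x y xB yB /(congr1 val); rewrite /= !inordK ?ltnS; last 2 first.
- by apply: le_truncn; rewrite ler_pM2r ?invr_gt0// lerD2r (le_trans (ler_norm _)).
- by apply: le_truncn; rewrite ler_pM2r ?invr_gt0// lerD2r (le_trans (ler_norm _)).
move=> xy.
have h z (k := Num.truncn ((z + B) / e)) : `|z| <= B ->
    k%:R <= (z + B) / e < k.+1%:R.
  move=> zB; apply: truncn_itv; apply: divr_ge0 (ltW e0).
  by move: zB; rewrite ler_norml; lra.
have := h _ xB; have := h _ yB; rewrite xy; set m := _%:R.
rewrite -natr1 -/m !ler_pdivlMr// !ltr_pdivrMr// ler_norml; nra.
Qed.

Lemma finite_coloring_complex (B e : R) : 0 < e -> exists (K : finType) (c : R[i] -> K),
  forall z w, Normc.normc z <= B -> Normc.normc w <= B -> c z = c w ->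
    Normc.normc (z - w) <= e.
Proof.
move=> e0; have e20 : 0 < e / 2 by rewrite divr_gt0.
have [N [c cP]] := finite_coloring_real B e20.
exists ('I_N.+1 * 'I_N.+1)%type, (fun z => (c (complex.Re z), c (complex.Im z))).
move=> z w zB wB [cRe cIm]; rewrite (le_trans (modulus_le_ReIm _))// !raddfB/= (splitr e).
by rewrite lerD//; apply: cP => //;
  by [apply: le_trans (modulus_Re _) _|apply: le_trans (modulus_Im _) _].
Qed.

End FiniteColorings.

(** * Bounded paths in the plane *)

Section Paths.
Variable R : realType.
Local Notation C := R[i]^o.
Local Notation modulus := (@Normc.normc R).

Definition paths (r : R) : set (R -> C) :=
  [set b : R -> C | continuous b /\ forall u, modulus (b u) <= r].

(** Linear interpolation of the two corrections, followed by the retraction onto the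
    disc: each of the two steps costs at most [e]. *)
Lemma endpoint_correction (r : R) (b : R -> C) (s t : R) (w0 w1 : C) : 0 < r -> s < t ->
  paths r b -> modulus w0 <= r -> modulus w1 <= r ->
  exists b' : R -> C, [/\ paths r b', b' s = w0, b' t = w1 &
    forall e u, modulus (w0 - b s) <= e -> modulus (w1 - b t) <= e ->
      s <= u <= t -> modulus (b' u - b u) <= 2 * e].
Proof.
move=> r0 st [bc br] w0r w1r.
pose l0 (u : R) : R := (t - u) / (t - s); pose l1 (u : R) : R := (u - s) / (t - s).
have ts0 : t - s != 0 by rewrite subr_eq0 gt_eqF.
pose g (u : R) : C := (w0 - b s) * (l0 u)%:C%C + (w1 - b t) * (l1 u)%:C%C.
exists (fun u => disc_retract r (b u + g u)); split.
- split=> [u|u]; last exact: modulus_disc_retract.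
  apply: (@continuous_comp R C C (fun u => b u + g u)); last exact: continuous_disc_retract.
  apply: cvgD; first exact: bc.
  apply: cvgD; (apply: cvgM; first exact: cvg_cst).
    apply: (@continuous_comp R R C l0); last exact: continuous_real_complex.
    by apply: cvgM; [apply: cvgB; [exact: cvg_cst|exact: cvg_id]|exact: cvg_cst].
  apply: (@continuous_comp R R C l1); last exact: continuous_real_complex.
  by apply: cvgM; [apply: cvgB; [exact: cvg_id|exact: cvg_cst]|exact: cvg_cst].
- rewrite /g /l0 /l1 subrr mul0r divff// mulr1 mulr0 addr0 addrC subrK.
  exact: disc_retract_id.
- rewrite /g /l0 /l1 subrr mul0r divff// mulr1 mulr0 add0r addrC subrK.
  exact: disc_retract_id.
move=> e u w0e w1e /andP[su ut].
have ge : modulus (g u) <= e.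
  have l00 : 0 <= l0 u by rewrite divr_ge0 ?subr_ge0// ltW.
  have l10 : 0 <= l1 u by rewrite divr_ge0 ?subr_ge0// ltW.
  have l01 : l0 u + l1 u = 1 by rewrite /l0 /l1 -mulrDl addrA subrK divff.
  rewrite (le_trans (le_normcD _ _))// !Normc.normcM !modulus_real !ger0_norm//.
  by rewrite -[e]mulr1 -l01 mulrDr lerD// ler_wpM2r.
have e0 : 0 <= e by apply: le_trans ge; exact: modulus_ge0.
rewrite (le_trans (modulus_dist_triangle (b u + g u) _ _))//.
rewrite [b u + g u - b u]addrAC subrr add0r mulr2n mulrDl !mul1r lerD//.
rewrite (le_trans (disc_retract_dist _ r0))// ge_max e0/= lerBlDl.
by rewrite (le_trans (le_normcD _ _))// lerD.
Qed.

Definition cuts (t : nat -> R) := (forall l, t l < t l.+1) /\ (forall x, exists l, x < t l).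

Lemma cuts_le t : cuts t -> {homo t : m n / (m <= n)%N >-> m <= n}.
Proof.
by move=> [t_lt _]; apply: homo_leq => // [? ? ?|n]; [exact: le_trans|exact: ltW].
Qed.

Lemma cuts_cover t l0 u : cuts t -> t l0 <= u ->
  exists2 l, (l0 <= l)%N & t l <= u <= t l.+1.
Proof.
move=> tc tu; case: (ex_minnP (tc.2 u)) => m um mmin.
have l0m : (l0 < m)%N.
  by rewrite ltnNge; apply/negP => /(cuts_le tc)/(lt_le_trans um); rewrite ltNge tu.
case: m um mmin l0m => // m um mmin l0m; exists m => //.
by rewrite (ltW um) andbT leNgt; apply/negP => /mmin; rewrite ltnn.
Qed.

Lemma path_gluing (r : R) (t : nat -> R) (b : nat -> R -> C) : cuts t ->
  (forall l, paths r (b l)) -> (forall l, b l (t l.+1) = b l.+1 (t l.+1)) ->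
  exists2 b' : R -> C, paths r b' & forall l u, t l <= u <= t l.+1 -> b' u = b l u.
Proof.
move=> tc br bb; have t_le := cuts_le tc; have [t_lt t_unb] := tc.
(* G l follows b 0, ..., b l in turn; clamping the arguments at the cut points
   writes it as a sum of compositions, whose continuity needs no case analysis. *)
pose G := fix G l : R -> C := if l is l'.+1 then
  fun u => G l' (Num.min u (t l)) + b l (Num.max u (t l)) - b l (t l) else b 0%N.
have Gr l u : t l <= u -> G l u = b l u.
  elim: l u => [//|l IH] u /= tu.
  by rewrite (min_idPr tu) (max_idPl tu) IH ?ltW// bb addrAC subrr add0r.
have Gl l u : u <= t l.+1 -> G l.+1 u = G l u.
  by move=> ut /=; rewrite (min_idPl ut) (max_idPr ut) addrK.
have Glm l m u : (l <= m)%N -> u <= t l.+1 -> G m u = G l u.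
  move=> + ul; elim: m => [|m IH]; first by rewrite leqn0 => /eqP->.
  rewrite leq_eqVlt => /predU1P[->//|lm]; rewrite Gl ?IH//.
  by rewrite (le_trans ul)// t_le.
have Gc l : continuous (G l).
  elim: l => [|l IH]; first by have [] := br 0%N.
  move=> u /=; apply: cvgB; last exact: cvg_cst.
  apply: cvgD.
    apply: (@continuous_comp R R C (fun u => Num.min u (t l.+1))); last exact: IH.
    by apply: (@continuous_min R R id (cst (t l.+1))); [exact: cvg_id|exact: cvg_cst].
  apply: (@continuous_comp R R C (fun u => Num.max u (t l.+1))); last exact: (br l.+1).1.
  by apply: (@continuous_max R R id (cst (t l.+1))); [exact: cvg_id|exact: cvg_cst].
have Gb l u : modulus (G l u) <= r.
  elim: l u => [|l IH] u; first exact: (br 0%N).2.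
  have [ut|/ltW tu] := leP u (t l.+1); first by rewrite Gl.
  by rewrite Gr//; exact: (br l.+1).2.
have /choice[L tL] := t_unb.
have GE l u : u <= t l.+1 -> G (L u) u = G l u.
  move=> ul; have [Ll|/ltnW lL] := leqP (L u) l; last exact: Glm.
  by apply/esym; apply: Glm => //; rewrite (le_trans (ltW (tL u)))// t_le.
exists (fun u => G (L u) u); last first.
  by move=> l u /andP[tu ut]; rewrite (GE l)//; exact: Gr.
split=> [u|u]; last exact: Gb.
apply: cvg_trans (Gc (L u) u).
apply: near_eq_cvg; near=> w; apply/esym; apply: GE.
rewrite ltW//; apply: lt_trans (t_lt (L u)); near: w.
by exact: lt_nbhsl.
Unshelve. all: by end_near. Qed.

(** The coordinates come in the order of [extend], so a tuple of functions and the
    tuple of their classes grow together under a quantifier. *)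
Definition fcons T n (x : T) (f : 'I_n -> T) (i : 'I_n.+1) : T :=
  oapp f x (unlift ord0 i).

Definition tuple_paths n (d : 'I_n -> {posnum R}) (a : 'I_n -> R -> C) :=
  forall i, paths (d i)%:num (a i).

Lemma paths_fcons n b (a : 'I_n -> R -> C) (r : {posnum R}) d :
  paths r%:num b -> tuple_paths d a -> tuple_paths (fcons r d) (fcons b a).
Proof. by move=> rb da i; rewrite /fcons; case: unliftP => [j _|_] /=. Qed.

Lemma fcons_dist n b b' (a a' : 'I_n -> R -> C) u e :
  modulus (b u - b' u) <= e -> (forall i, modulus (a i u - a' i u) <= e) ->
  forall i, modulus (fcons b a i u - fcons b' a' i u) <= e.
Proof. by move=> be ae i; rewrite /fcons; case: unliftP => [j _|_] /=. Qed.

End Paths.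

(** * Iterated ultrafilter quantifiers *)

Section Ultrafilters.
Variable R : realType.

Lemma ultra_color (T : Type) (F : set_system T) (K : finType) (f : T -> K) :
  UltraFilter F -> exists c, F [set x | f x = c].
Proof.
move=> UF; apply: contrapT => /forallNP h.
have : \forall x \near F, forall c, f x <> c.
  by apply: filter_forall => c; have [/h|] := in_ultra_setVsetC [set x | f x = c] UF.
by move=> /filter_ex[x /(_ (f x))].
Qed.

(** The triple quantifier for almost all [n], almost all [s], almost all [t]; it
    plays the part of the homogeneous sets of Ramsey's theorem. *)
Definition frequent (U : set_system nat) (V : set_system R) (P : nat -> R -> R -> Prop) :=
  \forall n \near U, \forall s \near V, \forall t \near V, P n s t.

Lemma frequent_color (U : set_system nat) (V : set_system R) (K : finType)
    (f : nat -> R -> R -> K) : UltraFilter U -> UltraFilter V ->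
  exists c, frequent U V (fun n s t => f n s t = c).
Proof.
move=> UU UV.
have /choice[c1 c1P] : forall ns : nat * R, exists c, V [set t | f ns.1 ns.2 t = c].
  by move=> ns; exact: ultra_color.
have /choice[c2 c2P] : forall n, exists c, V [set s | c1 (n, s) = c].
  by move=> n; exact: ultra_color.
have [c cP] := ultra_color c2 UU; exists c.
apply: filterS cP => n /= <-; apply: filterS (c2P n) => s /= <-; exact: c1P (n, s).
Qed.

(** The points are chosen one after the other: [t (l + 1)] has to suit [t l] for the
    finitely many [k <= l], and to be a left endpoint good for almost all right ones,
    which keeps the construction going. *)
Lemma frequent_diagonal (U : set_system nat) (V : set_system R)
    (P : nat -> nat -> R -> R -> Prop) : UltraFilter U -> UltraFilter V ->
  (forall x, \forall s \near V, x < s) -> (forall m, frequent U V (P m)) ->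
  exists (nu : nat -> nat) (t : nat -> R), cuts t /\
    forall m k l, (m <= k <= l)%N -> P m (nu k) (t l) (t l.+1).
Proof.
move=> UU UV Vy UP.
have /choice[nu nuP] : forall k, exists n, forall m : 'I_k.+1,
    \forall s \near V, \forall t \near V, P m n s t.
  by move=> k; apply: (@filter_ex _ U); apply: filter_forall => m; exact: UP.
pose Q l s t := forall k : 'I_l.+1, forall m : 'I_k.+1, P m (nu k) s t.
pose G l := [set s | \forall t \near V, Q l s t].
have FV : Filter V by exact: (@filter_filter _ _ (@ultra_proper _ _ UV)).
have VG l : V (G l).
  pose Pk k s t := forall m : 'I_k.+1, P m (nu k) s t.
  have kV (k : 'I_l.+1) : \forall s \near V, \forall t \near V, Pk k s t.
    have := @filter_forall R 'I_k.+1
      (fun m s => \forall t \near V, P m (nu k) s t) V FV (nuP k).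
    apply: filterS => s h.
    exact: (@filter_forall R 'I_k.+1 (fun m t => P m (nu k) s t) V FV h).
  have := @filter_forall R 'I_l.+1 (fun k s => \forall t \near V, Pk k s t) V FV kV.
  apply: filterS => s h.
  exact: (@filter_forall R 'I_l.+1 (fun k t => Pk k s t) V FV h).
have step l s : G l s -> exists s', [/\ G l.+1 s', Q l s s', s < s' & l%:R < s'].
  move=> Gs; apply: (@filter_ex _ V); near=> s'; split; near: s'.
  - exact: VG.
  - exact: Gs.
  - exact: Vy.
  - exact: Vy.
have /choice[nx nxP] : forall ls : nat * R, exists s', G ls.1 ls.2 ->
    [/\ G ls.1.+1 s', Q ls.1 ls.2 s', ls.2 < s' & ls.1%:R < s'].
  move=> [l s]; have [/step[s' h]|nG] := pselect (G l s); first by exists s'.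
  by exists 0.
have [s0 Gs0] := filter_ex (VG 0%N).
pose t := fix t l := if l is l'.+1 then nx (l', t l') else s0.
have Gt l : G l (t l) by elim: l => [//|l /= /(nxP (l, _))[]].
have tP l : [/\ G l.+1 (t l.+1), Q l (t l) (t l.+1), t l < t l.+1 & l%:R < t l.+1].
  exact: (nxP (l, t l)) (Gt l).
exists nu, t; split.
  split=> [l|x]; first by have [] := tP l.
  exists (Num.truncn `|x|).+2; have [_ _ _] := tP (Num.truncn `|x|).+1.
  by apply: lt_trans; rewrite (le_lt_trans (ler_norm x))// truncnS_gt.
move=> m k l /andP[mk kl]; have [_ h _ _] := tP l.
exact: (h (Ordinal (kl : (k < l.+1)%N)) (Ordinal (mk : (m < k.+1)%N))).
Unshelve. all: by end_near. Qed.

End Ultrafilters.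

(** * Structures represented by paths, up to their behavior at infinity *)

(** [rep f a] reads: the bounded continuous function [f] on the line has the class
    [a] in the algebra [M] of such functions modulo those vanishing at +oo. The norm
    is then the limit superior, and the points of a ball lift to functions that take
    all their values in the disc of the same radius. *)
Record represents (R : realType) (M : cstar_structure R)
    (rep : (R -> R[i]) -> M -> Prop) : Prop := Represents {
  rep_zero : rep (cst 0) (czero M);
  rep_add : forall f g a b, rep f a -> rep g b ->
    rep (fun u => f u + g u) (cadd a b);
  rep_scale : forall k f a, rep f a -> rep (fun u => k * f u) (cscale k a);
  rep_mul : forall f g a b, rep f a -> rep g b ->
    rep (fun u => f u * g u) (cmul a b);
  rep_star : forall f a, rep f a -> rep (fun u => (f u)^*%C) (cstar a);
  cnorm_ge0 : forall a : M, 0 <= cnorm a;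
  rep_cnorm : forall f a c, 0 <= c -> rep f a -> (cnorm a <= c <->
    forall e, 0 < e -> \forall u \near +oo, Normc.normc (f u) <= c + e);
  rep_lift : forall r (a : M), 0 < r -> cnorm a <= r ->
    exists f : R -> R[i]^o,
      [/\ continuous f, forall u, Normc.normc (f u) <= r & rep f a];
  rep_ex : forall (r : R) (f : R -> R[i]^o), continuous f ->
    (forall u, Normc.normc (f u) <= r) -> exists a, rep f a }.

Section Saturation.
Variables (R : realType) (M : cstar_structure R) (rep : (R -> R[i]) -> M -> Prop).
Hypothesis repP : represents rep.
Local Notation C := R[i]^o.
Local Notation modulus := (@Normc.normc R).

Lemma lift_exists (p : M) : exists f, paths (cnorm p + 1) f /\ rep f p.
Proof.
have [||f [fc fb fp]] := @rep_lift _ _ _ repP (cnorm p + 1) p.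
- by rewrite ltr_wpDl// (cnorm_ge0 repP).
- by rewrite lerDl.
- by exists f.
Qed.

(** A fixed choice of functions for the parameters of formulas: a parameter must be
    the same function on both sides of every comparison below. *)
Definition lift (p : M) : R -> C := sval (cid (lift_exists p)).

Lemma lift_paths p : paths (cnorm p + 1) (lift p).
Proof. by rewrite /lift; case: cid => f []. Qed.

Lemma lift_rep p : rep (lift p) p.
Proof. by rewrite /lift; case: cid => f []. Qed.

Fixpoint path_eval n (a : 'I_n -> R -> C) (t : term M n) : R -> C :=
  match t with
  | TVar i => a i
  | TParam p => lift p
  | TZero => cst 0
  | TAdd t1 t2 => fun u => path_eval a t1 u + path_eval a t2 u
  | TScale c t1 => fun u => c * path_eval a t1 u
  | TMul t1 t2 => fun u => path_eval a t1 u * path_eval a t2 u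
  | TStar t1 => fun u => (path_eval a t1 u)^*%C
  end.

Lemma rep_path_eval n (a : 'I_n -> R -> C) (v : 'I_n -> M) (t : term M n) :
  (forall i, rep (a i) (v i)) -> rep (path_eval a t) (teval v t).
Proof.
move=> av; elim: t => /= [i|p||t1 IH1 t2 IH2|c t1 IH|t1 IH1 t2 IH2|t1 IH].
- exact: av.
- exact: lift_rep.
- exact: rep_zero.
- exact: rep_add.
- exact: rep_scale.
- exact: rep_mul.
- exact: rep_star.
Qed.

Lemma path_eval_lip n (d : 'I_n -> {posnum R}) (t : term M n) : exists B K : R,
  [/\ 0 <= B, 0 <= K,
   forall a u, (forall i, modulus (a i u) <= (d i)%:num) ->
     modulus (path_eval a t u) <= B &
   forall a a' u e, (forall i, modulus (a i u) <= (d i)%:num) ->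
     (forall i, modulus (a' i u) <= (d i)%:num) -> 0 <= e ->
     (forall i, modulus (a i u - a' i u) <= e) ->
     modulus (path_eval a t u - path_eval a' t u) <= K * e].
Proof.
elim: t => /= [i|p||t1 [B1 [K1 [B10 K10 b1 l1]]] t2 [B2 [K2 [B20 K20 b2 l2]]]
  |c t1 [B1 [K1 [B10 K10 b1 l1]]]
  |t1 [B1 [K1 [B10 K10 b1 l1]]] t2 [B2 [K2 [B20 K20 b2 l2]]]
  |t1 [B1 [K1 [B10 K10 b1 l1]]]].
- exists (d i)%:num, 1; split=> // a a' u e ad a'd e0 aa'.
  by rewrite mul1r.
- exists (cnorm p + 1), 0; split=> // [|a u _|a a' u e _ _ e0 _].
  + by rewrite addr_ge0// (cnorm_ge0 repP).
  + by have [_] := lift_paths p; exact.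
  + by rewrite subrr Normc.normc0 mul0r.
- exists 0, 0; split=> // [a u _|a a' u e _ _ e0 _]; first by rewrite expr0n addr0 sqrtr0.
  by rewrite subr0 expr0n addr0 sqrtr0 mul0r.
- exists (B1 + B2), (K1 + K2); split; rewrite ?addr_ge0//.
    by move=> a u ad; rewrite (le_trans (le_normcD _ _))// lerD ?b1 ?b2.
  move=> a a' u e ad a'd e0 aa'; rewrite opprD addrACA.
  by rewrite (le_trans (le_normcD _ _))// mulrDl lerD ?l1 ?l2.
- exists (modulus c * B1), (modulus c * K1); split; rewrite ?mulr_ge0 ?modulus_ge0//.
    by move=> a u ad; rewrite Normc.normcM ler_wpM2l ?modulus_ge0// b1.
  move=> a a' u e ad a'd e0 aa'.
  by rewrite -mulrBr Normc.normcM -mulrA ler_wpM2l ?modulus_ge0// l1.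
- exists (B1 * B2), (B1 * K2 + B2 * K1); split; rewrite ?addr_ge0 ?mulr_ge0//.
    by move=> a u ad; rewrite Normc.normcM ler_pM ?modulus_ge0 ?b1 ?b2.
  move=> a a' u e ad a'd e0 aa'; set x := path_eval a t1 u; set x' := path_eval a' t1 u.
  set y := path_eval a t2 u; set y' := path_eval a' t2 u.
  have -> : x * y - x' * y' = x * (y - y') + y' * (x - x') by ring.
  rewrite (le_trans (le_normcD _ _))// !Normc.normcM mulrDl -!mulrA lerD//.
    by rewrite ler_pM ?modulus_ge0 ?b1 ?l2.
  by rewrite ler_pM ?modulus_ge0 ?b2 ?l1.
- exists B1, K1; split=> // [a u ad|a a' u e ad a'd e0 aa'].
    by rewrite modulus_conj b1.
  by rewrite -raddfB modulus_conj l1.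
Qed.

Lemma rep_fcons n b (a : 'I_n -> R -> C) h v :
  rep b h -> (forall i, rep (a i) (v i)) ->
  forall i, rep (fcons b a i) (extend h v i).
Proof.
by move=> bh av i; rewrite /fcons /extend; case: unliftP => [j _|_] /=.
Qed.

Lemma rep_cnorm_le (f : R -> C) (a : M) (c : R) : 0 <= c -> rep f a ->
  (forall u, modulus (f u) <= c) -> cnorm a <= c.
Proof.
move=> c0 fa fc; apply/(rep_cnorm repP c0 fa) => e e0.
by apply: nearW => u; rewrite (le_trans (fc u))// lerDl ltW.
Qed.

Lemma rep_in_domains n (d : 'I_n -> {posnum R}) a v :
  tuple_paths d a -> (forall i, rep (a i) (v i)) -> in_domains d v.
Proof. by move=> ad av i; apply: rep_cnorm_le (av i) _ => //; exact: (ad i).2. Qed.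

Lemma tuple_lift n (d : 'I_n -> {posnum R}) v : in_domains d v ->
  exists2 a, tuple_paths d a & forall i, rep (a i) (v i).
Proof.
move=> vd.
have /choice[a aP] : forall i, exists f, paths (d i)%:num f /\ rep f (v i).
  by move=> i; have [f [? ? ?]] := rep_lift repP [gt0 of (d i)%:num] (vd i); exists f.
by exists a => i; have [] := aP i.
Qed.

Lemma in_domains_extend n h (v : 'I_n -> M) (r : {posnum R}) d :
  cball r%:num h -> in_domains d v -> in_domains (fcons r d) (extend h v).
Proof.
by move=> hr vd i; rewrite /fcons /extend; case: unliftP => [j _|_] /=; last exact: hr.
Qed.

Lemma cball_czero (r : {posnum R}) : cball r%:num (czero M).
Proof. by apply: (rep_cnorm_le _ (rep_zero repP)) => // u; rewrite Normc.normc0. Qed.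

Lemma feval_bounded n (phi : formula M n) (d : 'I_n -> {posnum R}) :
  exists2 B, 0 <= B & forall v, in_domains d v -> `|feval phi v| <= B.
Proof.
elim: phi d => {n} /= [n tm|n k u uc psi IH|n r psi IH|n r psi IH] d.
- have [B [_ [B0 _ bnd _]]] := path_eval_lip d tm; exists B => // v vd.
  have [a ad av] := tuple_lift vd.
  rewrite ger0_norm ?(cnorm_ge0 repP)//.
  apply: (@rep_cnorm_le (path_eval a tm)) => //; first exact: rep_path_eval.
  by move=> u; apply: bnd => i; exact: (ad i).2.
- have /choice[B BP] : forall i, exists B, forall v, in_domains d v ->
      `|feval (psi i) v| <= B.
    by move=> i; have [B _ h] := IH i d; exists B.
  have [D D0 DP] := box_bounded (\sum_i `|B i|) uc; exists D => // v vd.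
  apply: DP => i; rewrite mxE (le_trans (BP i v vd))// (le_trans (ler_norm _))//.
  by rewrite (bigD1 i)//= lerDl sumr_ge0.
- have [B B0 HB] := IH (fcons r d); exists B => // v vd.
  apply: sup_norm_le.
    by exists (feval psi (extend (czero M) v)), (czero M) => //; exact: cball_czero.
  by move=> _ [h hr <-]; apply: HB; exact: in_domains_extend.
- have [B B0 HB] := IH (fcons r d); exists B => // v vd.
  apply: inf_norm_le.
    by exists (feval psi (extend (czero M) v)), (czero M) => //; exact: cball_czero.
  by move=> _ [h hr <-]; apply: HB; exact: in_domains_extend.
Qed.

(** * The local back-and-forth relation *)

(** The answers keep the exact endpoint values, for the gluing of answers given on
    adjacent intervals. The condition on an atomic formula bears on all the values
    of the modulus and not only on their supremum, which makes the relation an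
    instance of [zigzag] at every level. *)
Fixpoint similar n (phi : formula M n) (e s t : R) :
    ('I_n -> R -> C) -> ('I_n -> R -> C) -> Prop :=
  match phi with
  | FNorm _ tm => fun a a' => zigzag [set u | s <= u <= t] (fun u u' =>
      `|modulus (path_eval a tm u) - modulus (path_eval a' tm u')| <= e)
  | FConn _ _ _ _ psi => fun a a' => forall i, similar (psi i) e s t a a'
  | FSup _ r psi | FInf _ r psi => fun a a' =>
      zigzag (paths r%:num) (fun b b' => [/\ b s = b' s, b t = b' t &
        similar psi e s t (fcons b a) (fcons b' a')])
  end.

Lemma similar_trans n (phi : formula M n) e1 e2 s t a1 a2 a3 :
  similar phi e1 s t a1 a2 -> similar phi e2 s t a2 a3 ->
  similar phi (e1 + e2) s t a1 a3.
Proof.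
elim: phi a1 a2 a3 => {n} /= [n tm|n k u _ psi IH|n r psi IH|n r psi IH] a1 a2 a3.
- apply: zigzag_comp => x y z xy yz.
  rewrite -(subrKA (modulus (path_eval a2 tm y))).
  by rewrite (le_trans (ler_normD _ _))// lerD.
- by move=> h1 h2 i; exact: IH (h1 i) (h2 i).
- by apply: zigzag_comp => x y z [-> -> xy] [-> -> yz]; split=> //; exact: IH xy yz.
- by apply: zigzag_comp => x y z [-> -> xy] [-> -> yz]; split=> //; exact: IH xy yz.
Qed.

Lemma similar_sym n (phi : formula M n) e s t a a' :
  similar phi e s t a a' -> similar phi e s t a' a.
Proof.
elim: phi a a' => {n} /= [n tm|n k u _ psi IH|n r psi IH|n r psi IH] a a'.
- by case=> h1 h2; split=> u => [/h2|/h1] [y sy]; rewrite distrC; exists y.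
- by move=> h i; exact: IH.
- case=> h1 h2; split=> b => [/h2|/h1] [b' rb' [? ? ?]];
  by exists b' => //; split=> //; exact: IH.
- case=> h1 h2; split=> b => [/h2|/h1] [b' rb' [? ? ?]];
  by exists b' => //; split=> //; exact: IH.
Qed.

Lemma similar_le n (phi : formula M n) e1 e2 s t a1 a2 : e1 <= e2 ->
  similar phi e1 s t a1 a2 -> similar phi e2 s t a1 a2.
Proof.
move=> e12; elim: phi a1 a2 => {n} /= [n tm|n k u _ psi IH|n r psi IH|n r psi IH] a1 a2.
- by apply: zigzag_sub => x y _ _ /le_trans; exact.
- by move=> h i; exact: IH.
- by apply: zigzag_sub => x y _ _ [-> -> h]; split=> //; exact: IH.
- by apply: zigzag_sub => x y _ _ [-> -> h]; split=> //; exact: IH.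
Qed.

(** Each move is answered by itself, so the game ends in two tuples as close as the
    initial ones, where terms are Lipschitz. *)
Lemma similar_perturb n (phi : formula M n) (d : 'I_n -> {posnum R}) :
  exists2 K, 0 <= K & forall a a' e s t, 0 <= e ->
    tuple_paths d a -> tuple_paths d a' ->
    (forall i u, s <= u <= t -> modulus (a i u - a' i u) <= e) ->
    similar phi (K * e) s t a a'.
Proof.
elim: phi d => {n} /= [n tm|n k u _ psi IH|n r psi IH|n r psi IH] d.
- have [B [K [_ K0 _ lip]]] := path_eval_lip d tm.
  exists K => // a a' e s t e0 ad a'd aa'.
  apply: zigzag_refl => u su; apply: le_trans (modulus_lip _ _) _.
  by apply: lip => // i; [exact: (ad i).2|exact: (a'd i).2|exact: aa'].
- have /choice[K /all_and2[K0 HK]] : forall i, exists K, 0 <= K /\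
      forall a a' e s t, 0 <= e -> tuple_paths d a -> tuple_paths d a' ->
      (forall i u, s <= u <= t -> modulus (a i u - a' i u) <= e) ->
      similar (psi i) (K * e) s t a a'.
    by move=> i; have [K K0 h] := IH i d; exists K.
  exists (\sum_i K i); first by apply: sumr_ge0 => i _.
  move=> a a' e s t e0 ad a'd aa' i.
  apply: (@similar_le _ _ (K i * e)); last exact: HK.
  by rewrite ler_wpM2r// (bigD1 i)//= lerDl sumr_ge0.
- have [K K0 HK] := IH (fcons r d); exists K => // a a' e s t e0 ad a'd aa'.
  apply: zigzag_refl => b rb; split=> //.
  apply: HK => //; [exact: paths_fcons|exact: paths_fcons|move=> i u su].
  by apply: fcons_dist => [|j]; [rewrite subrr Normc.normc0|exact: aa'].
- have [K K0 HK] := IH (fcons r d); exists K => // a a' e s t e0 ad a'd aa'.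
  apply: zigzag_refl => b rb; split=> //.
  apply: HK => //; [exact: paths_fcons|exact: paths_fcons|move=> i u su].
  by apply: fcons_dist => [|j]; [rewrite subrr Normc.normc0|exact: aa'].
Qed.

Lemma similar_near n (phi : formula M n) (d : 'I_n -> {posnum R}) (e : R) : 0 < e ->
  exists2 de, 0 < de & forall a a' s t, tuple_paths d a -> tuple_paths d a' ->
    (forall i u, s <= u <= t -> modulus (a i u - a' i u) <= 2 * de) ->
    similar phi e s t a a'.
Proof.
move=> e0; have [K K0 HK] := similar_perturb phi d.
have K1 : 0 < K + 1 by rewrite ltr_wpDl.
have de0 : 0 < e / (2 * (K + 1)) by rewrite divr_gt0// mulr_gt0.
exists (e / (2 * (K + 1))) => // a a' s t ad a'd aa'.
apply: similar_le (HK _ _ _ s t _ ad a'd aa'); last by rewrite mulr_ge0// ltW.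
have -> : K * (2 * (e / (2 * (K + 1)))) = e * (K / (K + 1)) by field; rewrite gt_eqF.
by rewrite ler_piMr ?(ltW e0)// ler_pdivrMr// mul1r lerDl.
Qed.

Lemma similar_eq n (phi : formula M n) (d : 'I_n -> {posnum R}) a a' s t :
  tuple_paths d a -> tuple_paths d a' ->
  (forall i u, s <= u <= t -> a i u = a' i u) -> similar phi 0 s t a a'.
Proof.
move=> ad a'd aa'; have [K _ HK] := similar_perturb phi d.
rewrite -(mulr0 K); apply: HK => // i u su.
by rewrite aa'// subrr Normc.normc0.
Qed.

(** * Finitely many local types *)

(** The number of colors must not depend on the interval, because one ultrafilter
    argument deals with all intervals at once. *)
Definition finitely_colorable n (d : 'I_n -> {posnum R})
    (S : R -> R -> ('I_n -> R -> C) -> ('I_n -> R -> C) -> Prop) :=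
  exists (K : finType) (c : ('I_n -> R -> C) -> R -> R -> K),
  forall a a' s t, s < t -> tuple_paths d a -> tuple_paths d a' ->
    c a s t = c a' s t -> S s t a a'.

(** The color of [a] is the set of the colors of the tuples [b, a], together with
    approximate endpoint values of [b], for all moves [b]. Equal colors provide an
    answer whose endpoint values are approximately right, which a small correction
    makes exact. *)
Lemma finitely_colorable_quantifier n (psi : formula M n.+1) (r : {posnum R})
    (d : 'I_n -> {posnum R}) (e : R) : 0 < e ->
  finitely_colorable (fcons r d) (similar psi (e / 2)) ->
  finitely_colorable d (similar (FSup r psi) e).
Proof.
move=> e0 [K1 [c1 c1P]].
have e20 : 0 < e / 2 by rewrite divr_gt0.
have [de de0 near_de] := similar_near psi (fcons r d) e20.
have [K2 [c2 c2P]] := finite_coloring_complex r%:num de0.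
pose col a s t b := (c1 (fcons b a) s t, c2 (b s), c2 (b t)).
exists {set K1 * K2 * K2}, (fun a s t => hit_colors (paths r%:num) (col a s t)).
have half a a' s t : s < t -> tuple_paths d a -> tuple_paths d a' ->
    zigzag (paths r%:num) (fun b b' => col a s t b = col a' s t b') ->
    forall b, paths r%:num b -> exists2 b', paths r%:num b' &
      [/\ b s = b' s, b t = b' t & similar psi e s t (fcons b a) (fcons b' a')].
  move=> st ad a'd [h _] b rb; have [b1 rb1 [bb1 bs bt]] := h b rb.
  have [b2 [rb2 b2s b2t b21]] :=
    endpoint_correction [gt0 of r%:num] st rb1 (rb.2 s) (rb.2 t).
  exists b2 => //; split=> //; rewrite (splitr e).
  apply: (@similar_trans _ _ _ _ _ _ _ (fcons b1 a')).
    by apply: c1P => //; exact: paths_fcons.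
  apply: near_de => [||i u su]; [exact: paths_fcons|exact: paths_fcons|].
  apply: fcons_dist => [|j]; last by rewrite subrr Normc.normc0 mulr_ge0// ltW.
  rewrite modulusB; apply: b21 => //;
  by apply: c2P => //; [exact: rb.2|exact: rb1.2].
move=> a a' s t st ad a'd /[dup] /hit_colors_zigzag h /esym/hit_colors_zigzag h'.
split=> [b rb|b rb]; first exact: half.
have [b' rb' [? ? ?]] := half _ _ _ _ st a'd ad h' b rb.
by exists b' => //; split=> //; exact: similar_sym.
Qed.

Lemma similar_coloring n (phi : formula M n) (d : 'I_n -> {posnum R}) (e : R) :
  0 < e -> finitely_colorable d (similar phi e).
Proof.
elim: phi d e => {n} [n tm|n k u uc psi IH|n r psi IH|n r psi IH] d e e0.
- have [B [_ [_ _ bnd _]]] := path_eval_lip d tm.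
  have [N [c cP]] := finite_coloring_real B e0.
  exists {set 'I_N.+1}, (fun a s t =>
    hit_colors [set u | s <= u <= t] (fun u => c (modulus (path_eval a tm u)))).
  move=> a a' s t st ad a'd /hit_colors_zigzag; apply: zigzag_sub => x y _ _.
  by apply: cP; rewrite ger0_norm ?modulus_ge0// bnd// => i;
    [exact: (ad i).2|exact: (a'd i).2].
- pose P i (K : finType) := exists c : ('I_n -> R -> C) -> R -> R -> K,
    forall a a' s t, s < t -> tuple_paths d a -> tuple_paths d a' ->
    c a s t = c a' s t -> similar (psi i) e s t a a'.
  pose K i : {K | P i K} := cid (IH i d e e0).
  pose c i := cid (svalP (K i)).
  exists {dffun forall i, sval (K i)},
    (fun a s t => [ffun i => sval (c i) a s t] : {dffun forall i, sval (K i)}).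
  move=> a a' s t st ad a'd cc i; apply: (svalP (c i)) => //.
  have /(congr1 (fun f : {dffun forall i, sval (K i)} => f i)) := cc.
  by rewrite !ffunE.
- by apply: finitely_colorable_quantifier => //; apply: IH; rewrite divr_gt0.
- by apply: finitely_colorable_quantifier => //; apply: IH; rewrite divr_gt0.
Qed.

(** * From local similarity to values of formulas *)

Lemma similar_cnorm_le (f f' : R -> C) (h h' : M) (t : nat -> R) (e : R) :
  0 <= e -> cuts t -> rep f h -> rep f' h' ->
  (forall l u, t l <= u <= t l.+1 -> exists2 u', t l <= u' <= t l.+1 &
     `|modulus (f u) - modulus (f' u')| <= e) -> cnorm h <= cnorm h' + e.
Proof.
move=> e0 tc fh fh' ff'.
have he0 : 0 <= cnorm h' + e by rewrite addr_ge0// (cnorm_ge0 repP).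
apply/(rep_cnorm repP he0 fh) => e' e'0.
have [A [_ Af']] := (rep_cnorm repP (cnorm_ge0 repP h') fh').1 (lexx _) e' e'0.
have [l0 Al0] := tc.2 A.
near=> u.
have tu : t l0 <= u by near: u; apply: nbhs_pinfty_ge; exact: num_real.
have [l l0l /ff'[u' /andP[tu' _] uu']] := cuts_cover tc tu.
have /Af' : A < u' by rewrite (lt_le_trans Al0)// (le_trans _ tu')// (cuts_le tc).
by move: uu'; rewrite /= ler_norml; lra.
Unshelve. all: by end_near. Qed.

Definition similarity_controls n (phi : formula M n) (d : 'I_n -> {posnum R})
    (e eta : R) :=
  forall a a' v v' (t : nat -> R), cuts t ->
    tuple_paths d a -> tuple_paths d a' ->
    (forall i, rep (a i) (v i)) -> (forall i, rep (a' i) (v' i)) ->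
    (forall l, similar phi e (t l) (t l.+1) a a') ->
    `|feval phi v - feval phi v'| <= eta.

(** An element of the ball is lifted to a path, the game is played separately on each
    interval, and the answers are glued at the cut points, where they agree. *)
Lemma quantifier_response n (psi : formula M n.+1) (r : {posnum R}) d e eta a a' v v' t :
  similarity_controls psi (fcons r d) e eta -> cuts t ->
  tuple_paths d a -> tuple_paths d a' ->
  (forall i, rep (a i) (v i)) -> (forall i, rep (a' i) (v' i)) ->
  (forall l, similar (FSup r psi) e (t l) (t l.+1) a a') ->
  forall h, cball r%:num h -> exists2 h', cball r%:num h' &
    `|feval psi (extend h v) - feval psi (extend h' v')| <= eta.
Proof.
move=> ctl tc ad a'd av a'v' sim h hr.
have [b [bc br bh]] := rep_lift repP [gt0 of r%:num] hr.
have rb : paths r%:num b by [].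
have /choice[b' b'P] : forall l, exists b', paths r%:num b' /\
     [/\ b (t l) = b' (t l), b (t l.+1) = b' (t l.+1) &
      similar psi e (t l) (t l.+1) (fcons b a) (fcons b' a')].
  by move=> l; have [b' rb' h'] := (sim l).1 b rb; exists b'.
have [||g rg gb'] := @path_gluing _ r%:num t b' tc.
- by move=> l; have [] := b'P l.
- by move=> l; have [_ [_ <- _]] := b'P l; have [_ [<- _ _]] := b'P l.+1.
have [h' gh'] := rep_ex repP rg.1 rg.2.
exists h'; first by apply: rep_cnorm_le gh' rg.2.
apply: (ctl (fcons b a) (fcons g a') _ _ t tc);
  [exact: paths_fcons|exact: paths_fcons|exact: rep_fcons|exact: rep_fcons|move=> l].
have [rb' [_ _ sim_l]] := b'P l; rewrite -[e]addr0; apply: similar_trans sim_l _.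
apply: similar_eq; [exact: paths_fcons rb' a'd|exact: paths_fcons rg a'd|move=> i u tu].
by rewrite /fcons; case: unliftP => [j _|_] //=; rewrite (gb' l).
Qed.

Lemma quantifier_values n (psi : formula M n.+1) (r : {posnum R}) d e eta a a' v v' t
    (V := fun w : 'I_n -> M => [set feval psi (extend h w) | h in cball r%:num]) :
  similarity_controls psi (fcons r d) e eta -> cuts t ->
  tuple_paths d a -> tuple_paths d a' ->
  (forall i, rep (a i) (v i)) -> (forall i, rep (a' i) (v' i)) ->
  (forall l, similar (FSup r psi) e (t l) (t l.+1) a a') ->
  (forall x, V v x -> exists2 y, V v' y & `|x - y| <= eta) /\
  (forall y, V v' y -> exists2 x, V v x & `|x - y| <= eta).
Proof.
move=> ctl tc ad a'd av a'v' sim; split=> _ [h hr <-].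
  have [h' h'r hh'] := quantifier_response ctl tc ad a'd av a'v' sim hr.
  by exists (feval psi (extend h' v')) => //; exists h'.
have [h' h'r hh'] :=
  quantifier_response ctl tc a'd ad a'v' av (fun l => similar_sym (sim l)) hr.
by exists (feval psi (extend h' v)); [exists h'|rewrite distrC].
Qed.

Lemma similar_feval n (phi : formula M n) (d : 'I_n -> {posnum R}) (eta : R) :
  0 < eta -> exists2 e, 0 < e & similarity_controls phi d e eta.
Proof.
elim: phi d eta => {n} [n tm|n k u uc psi IH|n r psi IH|n r psi IH] d eta eta0.
- exists eta => // a a' v v' t tc _ _ av a'v' sim.
  have fv := rep_path_eval tm av; have f'v' := rep_path_eval tm a'v'.
  rewrite ler_distlC; apply/andP; split; rewrite ?lerBlDr.
    by apply: (similar_cnorm_le (ltW eta0) tc fv f'v') => l; exact: (sim l).1.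
  apply: (similar_cnorm_le (ltW eta0) tc f'v' fv) => l w tw.
  by have [w' tw' ww'] := (sim l).2 w tw; exists w' => //; rewrite distrC.
- (* The values of the subformulas stay in a compact box, where u is uniformly
     continuous. *)
  have /choice[B BP] : forall i, exists B, forall v, in_domains d v ->
      `|feval (psi i) v| <= B.
    by move=> i; have [B _ h] := feval_bounded (psi i) d; exists B.
  have [e1 e10 e1P] := box_unif_continuous (\sum_i `|B i|) uc eta0.
  have /choice[e' e'P] : forall i, exists e', 0 < e' /\
      similarity_controls (psi i) d e' e1.
    by move=> i; have [e' ? ?] := IH i d e1 e10; exists e'.
  have [e e0 ee'] := common_lower_bound (fun i => (e'P i).1).
  exists e => // a a' v v' t tc ad a'd av a'v' sim.
  apply: e1P => i; rewrite !mxE.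
    rewrite (le_trans (BP i v (rep_in_domains ad av)))// (le_trans (ler_norm _))//.
    by rewrite (bigD1 i)//= lerDl sumr_ge0.
  apply: ((e'P i).2 a a' v v' t) => // l.
  exact: similar_le (ee' i) (sim l i).
- have [e e0 eP] := IH (fcons r d) eta eta0.
  exists e => // a a' v v' t tc ad a'd av a'v' sim.
  have [B B0 BP] := feval_bounded psi (fcons r d).
  have [h1 h2] := quantifier_values eP tc ad a'd av a'v' sim.
  apply: (@sup_dist_le _ _ _ B) => //.
  + by exists (feval psi (extend (czero M) v)), (czero M) => //; exact: cball_czero.
  + by move=> _ [h hr <-]; apply/BP/in_domains_extend => //; exact: rep_in_domains ad av.
  + by move=> _ [h hr <-]; apply/BP/in_domains_extend => //; exact: rep_in_domains a'd a'v'.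
- have [e e0 eP] := IH (fcons r d) eta eta0.
  exists e => // a a' v v' t tc ad a'd av a'v' sim.
  have [B B0 BP] := feval_bounded psi (fcons r d).
  have [h1 h2] := quantifier_values eP tc ad a'd av a'v' sim.
  apply: (@inf_dist_le _ _ _ B) => //.
  + by exists (feval psi (extend (czero M) v)), (czero M) => //; exact: cball_czero.
  + by move=> _ [h hr <-]; apply/BP/in_domains_extend => //; exact: rep_in_domains ad av.
  + by move=> _ [h hr <-]; apply/BP/in_domains_extend => //; exact: rep_in_domains a'd a'v'.
Qed.

(** * Splicing approximate solutions *)

(** [P k s t] says that [x k] has the color on [s, t] singled out by the ultrafilters.
    Any two functions of the sequence with that color can be spliced at [s] at the
    cost of a correction of size [de], and a tuple that follows such functions on
    successive intervals cannot be told by [phi] from a single one of them. *)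
Lemma frequent_splice n (phi : formula M n) (d : 'I_n -> {posnum R}) (eta : R)
    (x : nat -> 'I_n -> R -> C) (v : nat -> 'I_n -> M) U V :
  UltraFilter U -> UltraFilter V -> 0 < eta ->
  (forall k, tuple_paths d (x k)) -> (forall k i, rep (x k i) (v k i)) ->
  exists (P : nat -> R -> R -> Prop) (de : R), [/\ frequent U V P,
    forall k k' s t i, P k s t -> P k' s t -> modulus (x k i s - x k' i s) <= de &
    forall k (y : nat -> nat) t z w, cuts t ->
      tuple_paths d z -> (forall i, rep (z i) (w i)) ->
      (forall l, P k (t l) (t l.+1)) -> (forall l, P (y l) (t l) (t l.+1)) ->
      (forall l i u, t l <= u <= t l.+1 -> modulus (z i u - x (y l) i u) <= 2 * de) ->
      `|feval phi w - feval phi (v k)| <= eta].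
Proof.
move=> UU UV eta0 xd xv; have [e e0 econtrol] := similar_feval phi d eta0.
have e20 : 0 < e / 2 by rewrite divr_gt0.
have [de de0 near_de] := similar_near phi d e20.
have [K1 [c1 c1P]] := similar_coloring phi d e20.
have [K2 [c2 c2P]] := finite_coloring_complex (\sum_i (d i)%:num) de0.
pose c k s t := (c1 (x k) s t, [ffun i => c2 (x k i s)] : {ffun 'I_n -> K2}).
have [col colP] := frequent_color c UU UV.
exists (fun k s t => c k s t = col), de; split=> //.
  move=> k k' s t i <- [_ /ffunP/(_ i)]; rewrite !ffunE => /esym; apply: c2P;
  by rewrite (le_trans ((xd _ i).2 s))// (bigD1 i)//= lerDl sumr_ge0.
move=> k y t z w tc zd zw kcol ycol zx.
apply: (econtrol z (x k) w (v k) t tc) => // l; rewrite (splitr e).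
apply: (@similar_trans _ _ _ _ _ _ _ (x (y l))); first by apply: near_de => // i u; exact: zx.
apply: c1P => //; first exact: tc.1.
by have := ycol l; rewrite -(kcol l) => -[].
Qed.

Theorem represents_countably_saturated : countably_saturated M.
Proof.
move=> n d p p_cnt p_cons.
have [p0|[g]] := pfcard_geP p_cnt.
  exists (fun=> czero M) => [i|c]; first exact: cball_czero.
  by rewrite p0.
have eta0 j : 0 < j.+1%:R^-1 :> R by rewrite invr_gt0.
have [U [UU leU]] := ultraFilterLemma (@eventually_filter).
have [V [UV leV]] := ultraFilterLemma (@proper_pinfty_nbhs R).
have /choice[v vP] : forall k, exists v, in_domains d v /\
    forall q, (q <= k)%N -> `|feval (g q).1 v - (g q).2| <= k.+1%:R^-1.
  move=> k; have [|_ [q _ <-]|v vd vF] := p_cons (g @` `I_k.+1) _ _ _ (eta0 k).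
  - exact/finite_image/finite_II.
  - exact: funS.
  by exists v; split=> // q qk; apply: vF; exists q.
have /choice[x xP] : forall k, exists a, tuple_paths d a /\ forall i, rep (a i) (v k i).
  by move=> k; have [a] := tuple_lift (vP k).1; exists a.
have xd k : tuple_paths d (x k) by exact: (xP k).1.
have xv k i : rep (x k i) (v k i) by exact: (xP k).2.
(* The m-th demand asks for the condition g q with precision 1 / (j + 1), where the
   pair (q, j) is coded by m. *)
pose D m : nat * nat := odflt (0%N, 0%N) (unpickle m).
pose phi m := (g (D m).1).1; pose eta m : R := (D m).2.+1%:R^-1.
have eta_gt0 m : 0 < eta m by exact: eta0.
have /choice[P /choice[de PP]] :=
  fun m => frequent_splice (phi m) UU UV (eta_gt0 m) xd xv.
pose P' m k s t := P m k s t /\ ((D m).1 <= k)%N /\ ((D m).2 <= k)%N.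
have P'freq m : frequent U V (P' m).
  have [fr _ _] := PP m.
  have : \forall k \near U, ((D m).1 <= k)%N /\ ((D m).2 <= k)%N.
    by apply: leU; near=> k; split; near: k; exact: nbhs_infty_ge.
  by apply: filterS2 fr => k Pk Dk; apply: filterS Pk => s; apply: filterS.
have Vgt a : \forall s \near V, a < s.
  by apply: leV; apply: nbhs_pinfty_gt; exact: num_real.
have [nu [t [tc nutP]]] := frequent_diagonal UU UV Vgt P'freq.
pose y l := x (nu l).
have /choice[b bP] : forall li : nat * 'I_n, exists b : R -> C,
    [/\ paths (d li.2)%:num b, b (t li.1) = y li.1 li.2 (t li.1),
     b (t li.1.+1) = y li.1.+1 li.2 (t li.1.+1) &
     forall e u, 0 <= e ->
      modulus (y li.1.+1 li.2 (t li.1.+1) - y li.1 li.2 (t li.1.+1)) <= e ->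
      t li.1 <= u <= t li.1.+1 -> modulus (b u - y li.1 li.2 u) <= 2 * e].
  move=> [l i] /=; have [b [bd bs bt bye]] :=
    endpoint_correction [gt0 of (d i)%:num] (tc.1 l)
    (xd (nu l) i) ((xd (nu l) i).2 (t l)) ((xd (nu l.+1) i).2 (t l.+1)).
  exists b; split=> // e u e0 ye tu; apply: bye => //.
  by rewrite subrr Normc.normc0.
have /choice[z zP] : forall i, exists z, paths (d i)%:num z /\
    forall l u, t l <= u <= t l.+1 -> z u = b (l, i) u.
  move=> i; have [||z ? ?] := @path_gluing _ (d i)%:num t (fun l => b (l, i)) tc.
  - by move=> l; have [] := bP (l, i).
  - by move=> l; have [_ _ -> _] := bP (l, i); have [_ -> _ _] := bP (l.+1, i).
  - by exists z.
have zd : tuple_paths d z by move=> i; exact: (zP i).1.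
have /choice[w zw] : forall i, exists h, rep (z i) h.
  by move=> i; exact: (rep_ex repP (zd i).1 (zd i).2).
exists w => [|c pc]; first exact: rep_in_domains zd zw.
have [q _ <-] := @surj _ _ _ _ g _ pc.
apply/eqP; rewrite -subr_eq0 -normr_le0; apply/ler_addgt0Pl => e e0.
have e20 : 0 < e / 2 by rewrite divr_gt0.
have [j /= /ltW je] := filter_ex (near_infty_natSinv_lt (PosNum e20)).
pose m := pickle (q, j); have Dm : D m = (q, j) by rewrite /D pickleK.
have [_ de_small close] := PP m.
have [_ [qm jm]] : P' m (nu m) (t m) (t m.+1) by apply: nutP; rewrite !leqnn.
rewrite Dm /= in qm jm.
rewrite addr0 -(subrKA (feval (g q).1 (v (nu m)))).
rewrite (le_trans (ler_normD _ _))// (splitr e) lerD//; last first.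
  rewrite (le_trans ((vP (nu m)).2 q qm))// (le_trans _ je)//.
  by rewrite lef_pV2 ?posrE// ler_nat.
have -> : (g q).1 = phi m by rewrite /phi Dm.
have etam : eta m <= e / 2 by rewrite /eta Dm.
apply: le_trans etam.
(* The intervals before t m are dropped: they need not have the right color for the
   m-th demand. *)
apply: (close (nu m) (fun l => nu (m + l)%N) (fun l => t (m + l)%N) z w) => //.
- split=> [l|a]; first by rewrite addnS; exact: tc.1.
  have [l al] := tc.2 a; exists l; rewrite (lt_le_trans al)//.
  by apply: (cuts_le tc); rewrite leq_addl.
- by move=> l; rewrite addnS; apply: (nutP m m (m + l)%N _).1; rewrite leqnn leq_addr.
- move=> l; rewrite addnS; apply: (nutP m (m + l)%N (m + l)%N _).1.
  by rewrite leqnn leq_addr.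
move=> l i u; rewrite addnS => tu.
rewrite ((zP i).2 _ _ tu); have [_ _ _ bye] := bP ((m + l)%N, i).
(* On the interval starting at the common endpoint, both functions have the color
   of the m-th demand. *)
have ye : modulus (y (m + l).+1 i (t (m + l).+1) - y (m + l)%N i (t (m + l).+1))
    <= de m.
  apply: (de_small _ _ _ (t (m + l).+2)).
    by apply: (nutP m _ _ _).1; rewrite leqnn leqW// leq_addr.
  by apply: (nutP m _ _ _).1; rewrite leqnSn leq_addr.
by apply: bye => //; exact: le_trans (modulus_ge0 _) ye.
Unshelve. all: by end_near. Qed.

End Saturation.

(** * The Stone-Cech compactification *)

Section SubspaceType.
Variables (T : topologicalType) (A : set T).

Lemma set_val_continuous : continuous (set_val : A -> T).
Proof. exact: initial_continuous. Qed.

Lemma continuous_to_set_type (Y : topologicalType) (f : Y -> A) :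
  continuous (fun y => set_val (f y)) -> continuous f.
Proof. exact: continuous_comp_initial. Qed.

Lemma set_type_compact : compact A -> compact [set: A].
Proof.
move=> Acpt F PF _.
have FA : fmap set_val F A.
  by apply: (@filterS _ F _ setT) => [a _|]; [exact: set_valP|exact: filterT].
have [p [Ap pcl]] := Acpt (fmap set_val F) _ FA.
exists (exist _ p (mem_set Ap)); split=> // B N FB [W [[V oV <-] /= Vp] WN].
have [|_ [[b Bb <-] Vb]] := pcl (set_val @` B) V _ (open_nbhs_nbhs (conj oV Vp)).
  by apply: (@filterS _ F _ B) => // b Bb; exists b.
by exists b; split=> //; exact: WN.
Qed.

Lemma set_type_hausdorff : hausdorff_space T -> hausdorff_space A.
Proof.
move=> hT p q pq; apply: val_inj; apply: hT => B D pB qD.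
have [x [Bx Dx]] := pq _ _ (set_val_continuous pB) (set_val_continuous qD).
by exists (set_val x).
Qed.

End SubspaceType.

Section StoneCechCompact.
Variables (R : realType) (X : topologicalType).
Local Notation cube := (unit_cube R X).
Local Notation bX := (stone_cech R X).

Lemma unit_interval_compact : compact [set: unit_interval R].
Proof. by apply: set_type_compact; exact: segment_compact. Qed.

Lemma unit_cube_compact : compact [set: cube].
Proof.
have := @tychonoff (continuousType X (unit_interval R)) (fun=> unit_interval R)
  (fun=> setT) (fun=> unit_interval_compact).
by congr compact; apply/seteqP; split.
Qed.

Lemma unit_cube_hausdorff : hausdorff_space cube.
Proof.
by apply: hausdorff_product => f; apply: set_type_hausdorff; exact: order_hausdorff.
Qed.

Lemma stone_cech_compact : compact [set: bX].
Proof.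
apply: set_type_compact; apply: subclosed_compact unit_cube_compact _ => //.
exact: closed_closure.
Qed.

Lemma stone_cech_hausdorff : hausdorff_space bX.
Proof. apply: set_type_hausdorff; exact: unit_cube_hausdorff. Qed.

Definition coordinate (f : continuousType X (unit_interval R)) (y : bX) : R :=
  set_val (set_val y f).

Lemma coordinate_continuous f : continuous (coordinate f).
Proof.
move=> y; apply: (@continuous_comp bX (unit_interval R) R (fun y : bX => set_val y f)).
  apply: (@continuous_comp bX cube (unit_interval R) set_val (fun z : cube => z f)).
    exact: set_val_continuous.
  exact: proj_continuous.
exact: set_val_continuous.
Qed.

Lemma stone_cech_ev_continuous : continuous (@stone_cech_ev R X).
Proof.
move=> x; apply/cvg_sup => f B [_ [[V oV <-] /= Vfx] VB].
have := @cts_fun _ _ f x V (open_nbhs_nbhs (conj oV Vfx)).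
by apply: (@filterS _ (nbhs x) _ (f @^-1` V)) => y; exact: VB.
Qed.

Lemma stone_cech_in_continuous : continuous (@stone_cech_in R X).
Proof. by apply: continuous_to_set_type; exact: stone_cech_ev_continuous. Qed.

Lemma stone_cech_in_dense (y : bX) (N : set bX) : nbhs y N ->
  exists x, N (stone_cech_in R x).
Proof.
move=> [W [[V oV <-] /= Vy] WN].
have [_ [[x _ <-] Vx]] := set_valP y V (open_nbhs_nbhs (conj oV Vy)).
by exists x; exact: WN.
Qed.

(** An affine image of [f] has values in the unit interval, so it is one of the
    coordinates of the cube. *)
Lemma stone_cech_extend_real (f : X -> R) (B : R) : continuous f ->
  (forall x, `|f x| <= B) -> exists F : bX -> R, continuous F /\
    forall x, F (stone_cech_in R x) = f x.
Proof.
move=> fc fB; pose M := `|B| + 1; have M0 : 0 < M by rewrite ltr_wpDl.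
have fM x : `|f x| <= M by rewrite (le_trans (fB x))// (le_trans (ler_norm B))// lerDl.
pose h x := (f x + M) / (2 * M).
have hP x : h x \in `[0, 1]%classic.
  rewrite inE/= in_itv/= divr_ge0 ?ler_pdivrMr ?mulr_gt0 ?mulr_ge0 ?(ltW M0)//=;
  by have := fM x; rewrite ler_norml; lra.
have gc : continuous (fun x => exist _ (h x) (hP x) : unit_interval R).
  apply: continuous_to_set_type => x /=.
  by apply: cvgM; [apply: cvgD; [exact: fc|exact: cvg_cst]|exact: cvg_cst].
pose g : continuousType X (unit_interval R) := mkcts gc.
exists (fun y => coordinate g y * (2 * M) - M); split=> [y|x].
  apply: (@continuous_comp bX R R (coordinate g) (fun r => r * (2 * M) - M)).
    exact: coordinate_continuous.
  by apply: cvgB; [apply: cvgM; [exact: cvg_id|exact: cvg_cst]|exact: cvg_cst].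
by rewrite /coordinate /= /h divfK ?addrK// mulf_neq0 ?gt_eqF.
Qed.

Lemma stone_cech_extend (f : X -> R[i]^o) (B : R) : continuous f ->
  (forall x, Normc.normc (f x) <= B) -> exists F : bX -> R[i]^o, continuous F /\
    forall x, F (stone_cech_in R x) = f x.
Proof.
move=> fc fB.
have [|x|F1 [F1c F1E]] := @stone_cech_extend_real (fun x => complex.Re (f x)) B.
- by move=> x; apply: (@continuous_comp X R[i]^o R f); [exact: fc|exact: continuous_Re].
- exact: le_trans (modulus_Re _) (fB x).
have [|x|F2 [F2c F2E]] := @stone_cech_extend_real (fun x => complex.Im (f x)) B.
- by move=> x; apply: (@continuous_comp X R[i]^o R f); [exact: fc|exact: continuous_Im].
- exact: le_trans (modulus_Im _) (fB x).
exists (fun y => Complex (F1 y) (F2 y)); split=> [|x]; last by rewrite F1E F2E; case: (f x).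
exact: continuous_Complex.
Qed.

End StoneCechCompact.

(** * Functions on the remainder of the half-open interval *)

Lemma cnorm_continuous_functions_ge0 (R : realType) (K : topologicalType)
  (f : continuous_functions R K) : 0 <= cnorm f.
Proof.
rewrite /cnorm /=; set A := range (fun x => _).
have [Asup|/sup_out->//] := pselect (has_sup A).
have [_ [y _ _]] := Asup.1.
have Ay : A (Normc.normc (f y)) by exists y.
by apply: le_trans (sup_upper_bound Asup Ay); exact: modulus_ge0.
Qed.

Section HalfLine.
Variable R : realType.
Local Notation X := (half_open_interval R).
Local Notation bX := (stone_cech R X).
Local Notation rem := (stone_cech_remainder R X).
Local Notation C := R[i]^o.
Local Notation modulus := (@Normc.normc R).

(** The homeomorphism of the half-line onto [0, 1[, extended to the whole line so that
    partition arguments can deal with total functions. *)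
Definition contract (u : R) : R := Num.max 0 u / (1 + Num.max 0 u).

Lemma contract_in u : contract u \in `[0, 1[%classic.
Proof.
rewrite inE/= in_itv/= /contract; set v := Num.max 0 u.
have v0 : 0 <= v by rewrite le_max lexx.
by rewrite divr_ge0 ?addr_ge0//= ltr_pdivrMr ?ltr_wpDr// mul1r ltrDr.
Qed.

Lemma contract_gt (d : R) : d < 1 -> \forall u \near +oo, d < contract u.
Proof.
move=> d1; near=> u.
have u0 : 0 <= u by near: u; apply: nbhs_pinfty_ge; exact: num_real.
have ud : d / (1 - d) < u by near: u; apply: nbhs_pinfty_gt; exact: num_real.
rewrite /contract (max_idPr u0) ltr_pdivlMr ?ltr_wpDr//.
by move: ud; rewrite ltr_pdivrMr ?subr_gt0// mulrBr mulr1 mulrDr mulr1 [d * u]mulrC; lra.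
Unshelve. all: by end_near. Qed.

Definition half_line (u : R) : X := exist _ (contract u) (contract_in u).

Lemma half_line_continuous : continuous half_line.
Proof.
apply: continuous_to_set_type => u /=.
have mc : Num.max 0 w @[w --> u] --> Num.max 0 u.
  by apply: (@continuous_max R R (cst 0) id); [exact: cvg_cst|exact: cvg_id].
apply: cvgM; first exact: mc.
apply: cvgV; last by apply: cvgD; [exact: cvg_cst|exact: mc].
by rewrite gt_eqF// ltr_wpDr// le_max lexx.
Qed.

Definition expand (x : X) : R := set_val x / (1 - set_val x).

Lemma half_openP (x : X) : 0 <= set_val x < 1.
Proof. by have := set_valP x; rewrite /= in_itv. Qed.

Lemma expand_ge0 x : 0 <= expand x.
Proof. by have /andP[x0 x1] := half_openP x; rewrite /expand divr_ge0// subr_ge0 ltW. Qed.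

Lemma expand_continuous : continuous expand.
Proof.
move=> x; apply: (@continuous_comp X R R set_val (fun r => r / (1 - r))).
  exact: set_val_continuous.
apply: cvgM; first exact: cvg_id.
apply: cvgV; last by apply: cvgB; [exact: cvg_cst|exact: cvg_id].
by rewrite subr_eq0 gt_eqF//; case/andP: (half_openP x).
Qed.

Lemma half_lineK u : 0 <= u -> expand (half_line u) = u.
Proof.
move=> u0; rewrite /expand -[set_val _]/(contract u) /contract (max_idPr u0).
have u1 : 1 + u != 0 by rewrite gt_eqF// ltr_wpDr.
by field; rewrite u1 /= addrK oner_eq0.
Qed.

Lemma expandK x : half_line (expand x) = x.
Proof.
apply: val_inj => /=; rewrite /contract (max_idPr (expand_ge0 x)) /expand.
have /andP[_ x1] := half_openP x; rewrite -[sval x]/(set_val x); set v : R := set_val x.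
have v1 : 1 - v != 0 by rewrite subr_eq0 gt_eqF.
by field; rewrite v1 /= subrK oner_eq0.
Qed.

Lemma contract_lt_expand (a : R) x : contract a < set_val x -> a < expand x.
Proof.
have /andP[x0 x1] := half_openP x.
rewrite /contract /expand ltr_pdivrMr ?ltr_wpDr ?le_max ?lexx// ltr_pdivlMr ?subr_gt0//.
set v : R := set_val x; set b := Num.max 0 a => bv.
have ab : a <= b by rewrite le_max lexx orbT.
have : a * (1 - v) <= b * (1 - v) by rewrite ler_wpM2r// subr_ge0 ltW.
by move: bv; rewrite !mulrBr !mulrDr !mulr1 [b * v]mulrC; lra.
Qed.

Lemma inclusion_in (x : X) : set_val x \in `[0, 1]%classic.
Proof. by rewrite inE/= in_itv/=; case/andP: (half_openP x) => -> /ltW ->. Qed.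

Lemma inclusion_continuous : continuous
  (fun x : X => exist _ (set_val x) (inclusion_in x) : unit_interval R).
Proof. by apply: continuous_to_set_type; exact: set_val_continuous. Qed.

(** The extension of the inclusion of [0, 1[ into [0, 1]; its fiber over 1 is the
    remainder, which makes the latter closed and its neighborhoods explicit. *)
Definition height : bX -> R :=
  coordinate (mkcts inclusion_continuous : continuousType X (unit_interval R)).

Lemma height_continuous : continuous height.
Proof. exact: coordinate_continuous. Qed.

Lemma height_in x : height (stone_cech_in R x) = set_val x.
Proof. by []. Qed.

Lemma height_le1 y : height y <= 1.
Proof.
have := set_valP (set_val y (mkcts inclusion_continuous)).
by rewrite /= in_itv/= => /andP[].
Qed.

Definition half_line_in (u : R) : bX := stone_cech_in R (half_line u).

Lemma half_line_in_continuous : continuous half_line_in.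
Proof.
move=> u; apply: (@continuous_comp R X bX half_line); first exact: half_line_continuous.
exact: stone_cech_in_continuous.
Qed.

(** Near [y] the image of the interval lies in the image of a segment [0, a] of the
    half-line, which is compact, hence closed. *)
Lemma height_lt1 y : height y < 1 -> exists2 u, 0 <= u & y = half_line_in u.
Proof.
move=> y1; pose c := (height y + 1) / 2.
have yc : height y < c by rewrite /c; lra.
have c1 : c < 1 by rewrite /c; lra.
have Ecl : closed (half_line_in @` `[0, c / (1 - c)]%classic).
  apply: compact_closed; first exact: stone_cech_hausdorff.
  apply: continuous_compact; last exact: segment_compact.
  exact/continuous_subspaceT/half_line_in_continuous.
have [|u] := Ecl y; last by rewrite /= in_itv/= => /andP[u0 _] <-; exists u.
move=> N yN.
have yNc : nbhs y (N `&` [set z | height z < c]).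
  apply: filterI => //; exact: height_continuous (lt_nbhsl yc).
have [x [Nx]] := stone_cech_in_dense yNc; rewrite /= height_in => xc.
exists (stone_cech_in R x); split=> //.
exists (expand x); last by rewrite /half_line_in expandK.
have /andP[x0 x1] := half_openP x.
rewrite /= in_itv/= expand_ge0/= /expand ler_pdivrMr ?subr_gt0//.
rewrite mulrAC ler_pdivlMr ?subr_gt0//.
by rewrite !mulrBr !mulr1 mulrC lerD2r ltW.
Qed.

Lemma remainderP (y : bX) : (~` range (@stone_cech_in R X)) y <-> height y = 1.
Proof.
split=> [yr|y1 [x _ xy]]; last first.
  by case/andP: (half_openP x); rewrite -height_in xy y1 ltxx.
apply/eqP; rewrite eq_le height_le1/= leNgt; apply/negP => /height_lt1[u _ yu].
by apply: yr; rewrite yu; exists (half_line u).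
Qed.

Lemma remainder_closed : closed (~` range (@stone_cech_in R X)).
Proof.
have -> : ~` range (@stone_cech_in R X) = height @^-1` [set 1].
  by apply/seteqP; split=> y /remainderP.
apply: closed_comp; last exact: closed_eq.
by move=> y _; exact: height_continuous.
Qed.

Lemma remainder_compact : compact [set: rem].
Proof.
apply: set_type_compact.
exact: subclosed_compact remainder_closed (@stone_cech_compact R X) _.
Qed.

Definition rem_val (y : rem) : bX := set_val (y : ~` range (@stone_cech_in R X)).

Lemma rem_val_continuous : continuous rem_val.
Proof. exact: set_val_continuous. Qed.

Lemma cnorm_leP (h : continuous_functions R rem) (c : R) : 0 <= c ->
  cnorm h <= c <-> forall y, modulus (h y) <= c.
Proof.
move=> c0; pose f : rem -> C := h.
have fc : continuous f by exact: cts_fun.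
have [|B [_ BP]] := @compact_bounded R R (range (fun y => modulus (f y))).
  apply: continuous_compact; last exact: remainder_compact.
  apply: continuous_subspaceT => y.
  by apply: (@continuous_comp rem C R f); [exact: fc|exact: continuous_modulus].
have ub : has_ubound (range (fun y => modulus (f y))).
  exists (B + 1) => _ [y _ <-]; apply: le_trans (ler_norm _) _.
  by apply: (BP (B + 1)); [rewrite ltrDl|exists y].
split=> [hc y|hc].
  by apply: le_trans hc; apply: ub_le_sup => //; exists y.
rewrite /cnorm /=; have [[y0 ry0]|] := pselect (range (fun y => modulus (f y)) !=set0).
  by apply: ge_sup; [exists y0|move=> _ [y _ <-]; exact: hc].
by move=> /set0P/negP; rewrite negbK => /eqP; rewrite /f => ->; rewrite sup0.
Qed.

(** Only the values of [f] on the half-line count, [half_line_in] being constant on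
    the negative numbers. *)
Definition asymptotic (f : R -> R[i]) (h : continuous_functions R rem) : Prop :=
  exists F : continuous_functions R bX,
    (forall u, 0 <= u -> (F : bX -> C) (half_line_in u) = f u) /\
    (forall y, (F : bX -> C) (rem_val y) = (h : rem -> C) y).

(** If the bound holds on the remainder, it holds up to [e] near it, hence, by
    compactness, at the points of the half-line far enough. Conversely the half-line
    is dense, so that a value above the bound on the remainder is approached there. *)
Lemma asymptotic_cnorm f h c : 0 <= c -> asymptotic f h ->
  cnorm h <= c <-> forall e, 0 < e -> \forall u \near +oo, modulus (f u) <= c + e.
Proof.
move=> c0 [F [Ff Fh]]; pose G : bX -> C := F.
have Gc : continuous G by exact: cts_fun.
have mGc : continuous (fun y => modulus (G y)).
  by move=> y; apply: (@continuous_comp bX C R G); [exact: Gc|exact: continuous_modulus].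
rewrite cnorm_leP//; split=> [hc e e0|fc y].
  have c_ce : c < c + e by rewrite ltrDl.
  (* Near a point off the remainder, this holds vacuously for large u. *)
  pose P u y := y = half_line_in u -> modulus (G y) <= c + e.
  have : \forall u \near +oo, [set: bX] `<=` P u.
    apply: ((compact_near_coveringP _).1 (@stone_cech_compact R X)) => y _.
    have [y1|y1] := ltP (height y) 1.
      pose d := (height y + 1) / 2.
      have yd : height y < d by rewrite /d; lra.
      have d1 : d < 1 by rewrite /d; lra.
      exists ([set z | height z < d], [set u | d < contract u]) => [|[z u] [/= zd du] zu].
        split => /=; last exact: contract_gt.
        exact: height_continuous (lt_nbhsl yd).
      by move: zd; rewrite zu ltNge (ltW du).
    have /remainderP yr : height y = 1 by apply/eqP; rewrite eq_le height_le1.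
    have Gy : modulus (G y) < c + e.
      by rewrite (le_lt_trans _ c_ce)//; have := hc (exist _ y (mem_set yr)); rewrite -Fh.
    exists ([set z | modulus (G z) < c + e], setT) => [|[z u] [/= /ltW ze _] _ //].
    by split; [exact: mGc (lt_nbhsl Gy)|exact: filterT].
  apply: filterS2 (nbhs_pinfty_ge (num_real 0)) => u u0 Pu.
  by rewrite -Ff//; exact: Pu.
rewrite -Fh leNgt; apply/negP => cy.
pose e := (modulus (G (rem_val y)) - c) / 2.
have e0 : 0 < e by rewrite divr_gt0 ?subr_gt0.
have ey : c + e < modulus (G (rem_val y)).
  by move: cy; rewrite /e -/G; set m := modulus _; lra.
have [A [_ fA]] := fc e e0.
have y1 : contract A < height (rem_val y).
  rewrite ((remainderP _).1 (set_valP y)).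
  by have := contract_in A; rewrite inE/= in_itv/= => /andP[].
have yN : nbhs (rem_val y)
    ([set z | c + e < modulus (G z)] `&` [set z | contract A < height z]).
  by apply: filterI; [exact: mGc (lt_nbhsr ey)|exact: height_continuous (lt_nbhsr y1)].
have [x [/=]] := stone_cech_in_dense yN.
rewrite height_in => Gx Ax.
have := fA (expand x) (contract_lt_expand Ax); rewrite -Ff ?expand_ge0//.
by rewrite /half_line_in expandK leNgt Gx.
Qed.

(** Tietze's theorem gives lifts, first for the real and imaginary parts; the
    retraction onto the disc restores the bound on the modulus. *)
Lemma asymptotic_represents : represents asymptotic.
Proof.
split.
- by exists (czero (continuous_functions R bX)).
- move=> f g a b [F [Ff Fa]] [G [Gg Gb]]; exists (cadd F G).
  split=> [u u0|y]; [exact: (f_equal2 +%R (Ff u u0) (Gg u u0))|].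
  exact: (f_equal2 +%R (Fa y) (Gb y)).
- move=> k f a [F [Ff Fa]]; exists (cscale k F).
  split=> [u u0|y]; first exact: (congr1 ( *%R k) (Ff u u0)).
  exact: (congr1 ( *%R k) (Fa y)).
- move=> f g a b [F [Ff Fa]] [G [Gg Gb]]; exists (cmul F G).
  split=> [u u0|y]; [exact: (f_equal2 *%R (Ff u u0) (Gg u u0))|].
  exact: (f_equal2 *%R (Fa y) (Gb y)).
- move=> f a [F [Ff Fa]]; exists (cstar F).
  split=> [u u0|y]; first exact: (congr1 (@conjc R) (Ff u u0)).
  exact: (congr1 (@conjc R) (Fa y)).
- exact: cnorm_continuous_functions_ge0.
- by move=> f a c; exact: asymptotic_cnorm.
- move=> r h r0 /cnorm_leP hr; pose g : rem -> C := h.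
  have gr y : modulus (g y) <= r by apply: hr; exact: ltW.
  have gc : continuous g by exact: cts_fun.
  have nbX := compact_normal (@stone_cech_hausdorff R X) (@stone_cech_compact R X).
  have ext (p : C -> R) : continuous p -> (forall z, `|p z| <= modulus z) ->
      exists F : bX -> R, continuous F /\ forall y, F (rem_val y) = p (g y).
    move=> pc pm; pose q := valL_ (0 : R^o) (p \o g : ~` range (@stone_cech_in R X) -> R^o).
    have qE y : q (rem_val y) = p (g y) by rewrite -[RHS]/((p \o g) y) -(valLK 0 (p \o g)).
    have [||F [FE Fc _]] := @continuous_bounded_extension _ R nbX _ remainder_closed q r r0.
    + apply: (@subspace_valL_continuousP' bX (~` range (@stone_cech_in R X)) R^o 0
        (p \o g)).2 => y.
      by apply: (@continuous_comp rem C R g); [exact: gc|exact: pc].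
    + move=> x rx; rewrite -[x]/(rem_val (exist _ x (mem_set rx))) qE.
      exact: le_trans (pm _) (gr _).
    by exists F; split=> // y; rewrite -qE FE// inE; exact: set_valP.
  have [F1 [F1c F1E]] := ext _ (@continuous_Re R) (@modulus_Re R).
  have [F2 [F2c F2E]] := ext _ (@continuous_Im R) (@modulus_Im R).
  pose F y := disc_retract r (Complex (F1 y) (F2 y)).
  have Fc : continuous F.
    move=> y; apply: (@continuous_comp bX C C (fun y => Complex (F1 y) (F2 y))).
      exact: continuous_Complex.
    exact: continuous_disc_retract.
  exists (fun u => F (half_line_in u)); split=> [u|u|].
  + by apply: (@continuous_comp R bX C half_line_in); [exact: half_line_in_continuous|exact: Fc].
  + exact: modulus_disc_retract.
  exists (mkcts Fc : continuousType bX C); split=> //= y.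
  by rewrite /mkcts /F F1E F2E -[RHS](disc_retract_id r0 (gr y)); case: (g y).
- move=> r f fc fr; pose g (x : X) : C := f (expand x).
  have [||G [Gc GE]] := @stone_cech_extend R X g r.
  + by move=> x; apply: (@continuous_comp X R C expand); [exact: expand_continuous|exact: fc].
  + by move=> x; exact: fr.
  have hc : continuous (fun y : rem => G (rem_val y)).
    move=> y; apply: (@continuous_comp rem bX C rem_val); last exact: Gc.
    exact: rem_val_continuous.
  exists (mkcts hc : continuousType rem C), (mkcts Gc : continuousType bX C).
  split=> //= u u0.
  by rewrite /mkcts /half_line_in GE /g half_lineK.
Qed.

End HalfLine.

Theorem theorem1 (R : realType) :
  countably_saturated
    (continuous_functions R
      (stone_cech_remainder R (half_open_interval R))).
Proof. exact: represents_countably_saturated (asymptotic_represents R). Qed.
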